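(* There exist universal constants $\gamma,C>0$ with the following property. Let $2\le p<\infty$. For every integer $n\ge2$, if $\mathcal C$ is an $n$-point subset of $L_p$, then for every $\Delta>0$, $$\mathrm{SEP}_\Delta\Big(B_{L_p}\big(\mathcal C,\tfrac{\gamma}{p}\Delta\big)\Big)\le C\,p^2\sqrt{\log n}.$$ Furthermore, for every real $\lambda\ge2$, if $\mathcal D$ is a subset of $L_p$ that is $\lambda$-doubling, then for every $\Delta>0$, $$\mathrm{SEP}_\Delta\Big(B_{L_p}\big(\mathcal D,\tfrac{\gamma}{p}\Delta\big)\Big)\le C\big(p^2\sqrt{\log p}\big)\sqrt{\log\lambda}.$$
   Context: $L_p$ denotes the real Banach space $L_p([0,1])$ with Lebesgue measure. For a metric space $(\mathcal M,d)$, $\mathcal C\subseteq\mathcal M$ and $r\ge0$, $B_{\mathcal M}(\mathcal C,r)=\bigcup_{x\in\mathcal C}B_{\mathcal M}(x,r)$, where $B_{\mathcal M}(x,r)=\{y: d(x,y)\le r\}$; subsets carry the restricted metric. For an integer $\lambda\ge2$, $\mathcal M$ is $\lambda$-doubling if for every $r\ge0$ and $x\in\mathcal M$ there are $y_1,\dots,y_\lambda\in\mathcal M$ with $B_{\mathcal M}(x,2r)\subseteq\bigcup_{i=1}^{\lambda}B_{\mathcal M}(y_i,r)$; for real $\lambda\ge2$, $\lambda$-doubling means $\lfloor\lambda\rfloor$-doubling. For a partition $\mathcal P$ of $\mathcal M$ and $x\in\mathcal M$, $\mathcal P(x)$ is the element of $\mathcal P$ containing $x$. A random partition $\mathcal P$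 of $\mathcal M$ consists of a probability space $(\Omega,\mathbb P)$ and set-valued maps $\Gamma^1,\Gamma^2,\ldots:\Omega\to2^{\mathcal M}$ that are strongly measurable (for every $i$ and every closed $E\subseteq\mathcal M$, $\{\omega: E\cap\Gamma^i(\omega)\ne\emptyset\}$ is $\mathbb P$-measurable) such that for every $\omega$, $\mathcal P^\omega=\{\Gamma^k(\omega)\}_{k\in\mathbb N}$ is a partition of $\mathcal M$ (empty clusters allowed). It is $\Delta$-bounded if $\mathrm{diam}_{\mathcal M}(\mathcal P^\omega(x))\le\Delta$ for all $\omega$, $x$. A $\Delta$-bounded random partition is $\sigma$-separating ($\sigma\ge0$) if $\mathbb P[\mathcal P(x)\ne\mathcal P(y)]\le\frac{\sigma}{\Delta}d(x,y)$ for all $x,y\in\mathcal M$. $\mathrm{SEP}_\Delta(\mathcal M)$ is the infimum over $\sigma\ge0$ such that there is a $\Delta$-bounded $\sigma$-separating random partition of $\mathcal M$ ($\infty$ if none exists). *)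

(* Defs.v *)
From HB Require Import structures.
From mathcomp Require Import all_boot all_order all_algebra.
From mathcomp Require Import all_classical all_reals all_analysis.
From mathcomp Require Import measurable_realfun.

Set Implicit Arguments.
Unset Strict Implicit.
Unset Printing Implicit Defensive.
Import Order.TTheory GRing.Theory Num.Theory.
Import numFieldNormedType.Exports.

Local Open Scope classical_set_scope.
Local Open Scope ring_scope.

(* A subset of a metric space with the restricted metric; the uniformity and
   the balls on [set_type A] are those of subtype_topology. *)
Section subset_metric.
Context (R : realType) (M : metricType R) (A : set M).

Definition mdist_sub (x y : A) : R := mdist (set_val x) (set_val y).

Lemma mdist_sub_ge0 x y : 0 <= mdist_sub x y.
Proof. exact: mdist_ge0. Qed.

Lemma mdist_sub_positivity x y : mdist_sub x y = 0 -> x = y.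
Proof. by move=> xy0; apply: val_inj; exact: mdist_positivity xy0. Qed.

Lemma ballEmdist_sub (x : A) (d : R) :
  ball x d = [set y | mdist_sub x y < d].
Proof.
by rewrite /ball /= /initial_ball; apply/seteqP; split=> y /=; rewrite ballEmdist.
Qed.

HB.instance Definition _ := @PseudoMetric_isMetric.Build R (set_type A)
  mdist_sub mdist_sub_ge0 mdist_sub_positivity ballEmdist_sub.

End subset_metric.

(* L_p([0,1]): the library's space of a.e.-classes of Borel functions with
   finite p-norm, for Lebesgue measure restricted to [0,1] (so that values
   outside [0,1] are irrelevant). *)
Definition lebesgue01 (R : realType) :
    {measure set (measurableTypeR R) -> \bar R} :=
  mrestr (@lebesgue_measure R) (measurable_itv `[0, 1]%R).

Lemma lee1_ge2 (R : realType) (p : R) : 2 <= p -> (1 <= p%:E)%E.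
Proof. by move=> p2; rewrite lee_fin (le_trans _ p2)// ler1n. Qed.

Section Lp_metric.
Context (R : realType) (p : R) (p1 : (1 <= p%:E)%E).

Definition Lp : Type := LspaceType (lebesgue01 R) p1.

Definition Lp_dist (f g : Lp) : R :=
  fine (Lnorm (lebesgue01 R) p%:E (EFin \o ((f : R -> R) \- (g : R -> R)))).

Lemma Lp_Lfun (f : Lp) : (f : R -> R) \in Lfun (lebesgue01 R) p%:E.
Proof.
rewrite inE; apply/andP; split; rewrite inE /=; last exact: Lebesgue_finite.
move=> mT Y mY.
exact: (measurable_funPT
  (repr (f : {mfun_ lebesgue01 R, _ >-> measurableTypeR R}))).
Qed.

Lemma LpB_Lfun (f g : Lp) :
  ((f : R -> R) \- (g : R -> R)) \in Lfun (lebesgue01 R) p%:E.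
Proof.
have Dcl := (Lfun_addr_closed (lebesgue01 R) p1).2.
have Ncl := @Lfun_oppr_closed _ _ _ (lebesgue01 R) p%:E.
by have := Dcl _ _ (Lp_Lfun f) (Ncl _ (Lp_Lfun g)); exact.
Qed.

Lemma Lp_distE (f g : Lp) : (Lp_dist f g)%:E =
  Lnorm (lebesgue01 R) p%:E (EFin \o ((f : R -> R) \- (g : R -> R))).
Proof.
rewrite /Lp_dist fineK// fin_numElt (lt_le_trans ltNy0) ?Lnorm_ge0//=.
by have /sub_Lfun_finLfun := LpB_Lfun f g; rewrite inE.
Qed.

Lemma Lp_distxx f : Lp_dist f f = 0.
Proof.
apply: EFin_inj; rewrite Lp_distE.
rewrite (_ : _ \o _ = cst 0%E); last by apply/funext => x /=; rewrite subrr.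
by rewrite Lnorm0// gt_eqF// (lt_le_trans _ p1).
Qed.

Lemma Lp_dist_positivity f g : Lp_dist f g = 0 -> f = g.
Proof.
move=> fg0; have := Lp_distE f g; rewrite fg0 => /esym N0.
have /sub_Lfun_mfun := LpB_Lfun f g; rewrite inE /= => /measurable_EFinP mfg.
have := Lnorm_eq0_eq0 mfg (lt_le_trans lte01 p1) N0 => fg.
have {fg} : (f : R -> R) = (g : R -> R) %[ae lebesgue01 R].
  by apply: filterS fg => x /(_ I) /= [] /eqP; rewrite subr_eq0 => /eqP.
move=> fg.
case: f g fg {fg0 N0 mfg} => [f [[pf]]] [g [[pg]]] /= fg.
have /eqP := introT (ae_eqP f g) fg; rewrite !reprK => fg'.
by case: _ / fg' pg {fg} => pg; rewrite (Prop_irrelevance pf pg).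
Qed.

Lemma Lp_dist_sym f g : Lp_dist f g = Lp_dist g f.
Proof.
apply: EFin_inj; rewrite !Lp_distE -oppe_Lnorm; congr Lnorm.
by apply/funext => x; congr EFin => /=; rewrite opprB.
Qed.

Lemma Lp_dist_triangle g f h : Lp_dist f h <= Lp_dist f g + Lp_dist g h.
Proof.
rewrite -lee_fin EFinD !Lp_distE.
rewrite (_ : (f : R -> R) \- (h : R -> R) =
  (((f : R -> R) \- (g : R -> R)) \+ ((g : R -> R) \- (h : R -> R)))%R).
  apply: eminkowski => //.
  - by have /sub_Lfun_mfun := LpB_Lfun f g; rewrite inE.
  - by have /sub_Lfun_mfun := LpB_Lfun g h; rewrite inE.
by apply/funext => x /=; rewrite addrA subrK.
Qed.

HB.instance Definition _ := gen_eqMixin Lp.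
HB.instance Definition _ := gen_choiceMixin Lp.
HB.instance Definition _ := @isMetric.Build R Lp Lp_dist
  Lp_distxx Lp_dist_positivity Lp_dist_sym Lp_dist_triangle.

End Lp_metric.

(* Metrically closed balls; the library's [closed_ball] is the closure of the
   open ball. *)
Definition cball (R : realType) (M : metricType R) (x : M) (r : R) : set M :=
  [set y | mdist x y <= r].

Definition nbhd (R : realType) (M : metricType R) (C : set M) (r : R) : set M :=
  \bigcup_(x in C) cball x r.

(* For real lambda >= 0, [Num.truncn lambda] is the floor of lambda. *)
Definition doubling (R : realType) (M : metricType R) (lambda : R) : Prop :=
  forall (r : R) (x : M), 0 <= r ->
    exists y : 'I_(Num.truncn lambda) -> M,
      cball x (2 * r) `<=` \bigcup_i cball (y i) r.

Definition diam (R : realType) (M : metricType R) (A : set M) : \bar R :=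
  ereal_sup [set (mdist x y)%:E | x in A & y in A].

(* Clusters with distinct indices are disjoint and may be empty; the library's
   [partition] is not used because it requires nonempty blocks. *)
Record random_partition (R : realType) (M : metricType R) := RandomPartition {
  rp_display : measure_display ;
  rp_space : measurableType rp_display ;
  rp_prob : probability rp_space R ;
  rp_cluster : nat -> rp_space -> set M ;
  rp_measurable : forall k (E : set M), closed E ->
    measurable [set w | E `&` rp_cluster k w !=set0] ;
  rp_cover : forall w, cover setT (rp_cluster ^~ w) = setT ;
  rp_trivIset : forall w, trivIset setT (rp_cluster ^~ w)
}.

Arguments rp_space {R M} Pi : rename.
Arguments rp_prob {R M} Pi : rename.
Arguments rp_cluster {R M} Pi k w : rename.

(* The cluster containing x, written P(x) on paper. *)
Definition cluster_of (R : realType) (M : metricType R)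
    (Pi : random_partition M) (w : rp_space Pi) (x : M) : set M :=
  pblock setT ((rp_cluster Pi)^~ w) x.

Arguments cluster_of {R M} Pi w x.

Definition bounded_rp (R : realType) (M : metricType R) (Delta : R)
    (Pi : random_partition M) : Prop :=
  forall w x, (diam (cluster_of Pi w x) <= Delta%:E)%E.

Definition separating_rp (R : realType) (M : metricType R) (sigma Delta : R)
    (Pi : random_partition M) : Prop :=
  forall x y : M,
    (rp_prob Pi [set w | cluster_of Pi w x <> cluster_of Pi w y]
       <= (sigma / Delta * mdist x y)%:E)%E.

(* The infimum is taken in the extended reals: it is +oo if no sigma works. *)
Definition SEP (R : realType) (M : metricType R) (Delta : R) : \bar R :=
  ereal_inf [set sigma%:E | sigma in [set sigma : R | 0 <= sigma /\
    exists Pi : random_partition M,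
      bounded_rp Delta Pi /\ separating_rp sigma Delta Pi]].

(* Main.v *)
Require Import Defs.
From HB Require Import structures.
From mathcomp Require Import all_boot all_order all_algebra all_fingroup.
From mathcomp Require Import all_classical all_reals all_analysis.
From mathcomp Require Import measurable_realfun ring lra.

Set Implicit Arguments.
Unset Strict Implicit.
Unset Printing Implicit Defensive.
Import Order.TTheory GRing.Theory Num.Theory.
Import numFieldNormedType.Exports.

Local Open Scope classical_set_scope.
Local Open Scope ring_scope.

(* The signed power f |-> sg f |f|^(p/2) maps a ball of L_p into a ball of L_2,
   is O(p)-Lipschitz, and carries points that are close in L_2 back to points f, g
   for which f - z is at most (1 - 1/(8p)) r away from (g - z) / p.  Hence a
   partition of unity on the L_2 side turns clusters of radius r into clusters of
   radius (1 - 1/(8p)) r, at a separation cost O(p sqrt(log N)) / r when N points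
   suffice to approximate the cluster.  Iterating down to radius Delta / 2 gives a
   geometric series of total O(p^2 sqrt(log N)) / Delta.

   On the L_2 side a point is rounded at random to an integer grid, in orthonormal
   coordinates, and is sent to the point nearest to its rounding.  The rounding uses
   the product of quadratic B-splines: their square roots are Lipschitz, so that the
   Hellinger distance bounds the total variation, and their tails are subgaussian.

   All steps produce deterministic partitions of unity.  Only the last one is made
   random, by min-wise sampling with a uniform threshold and a uniform permutation;
   all events are then open from the right on the real line, hence Borel, without
   any appeal to the separability of L_p.

   For n points, N = n at every scale.  For a doubling set, a coloured net gives
   the first clusters, and the doubling property bounds N at each scale. *)

(** For p > 2 the inverse of the signed power is only Hölder, so an L_2 partition cannot be pulled
    back with comparable cluster radii. It suffices, however, to gain the factor 1 - 1/(8p) per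
    step, which only needs one common centre, a convex combination of z and y, for all f with image
    near that of y. The two powers of p have distinct origins: the Lipschitz constant of the signed
    power, and the sum 8p = 1/(1 - shrink) of the geometric series. The same Lipschitz constant
    forces a cluster of radius r to be approximated up to r/(100p); half of this is left for the
    neighbourhood, whence gamma = 1/400, as r >= Delta/2. For a doubling set, passing from radius 4r
    to r/(200p) takes O(log p) halvings, so log N is O(log p log lambda): this is the origin of
    sqrt(log p). The starting partition, whose constant is poor, is taken at an arbitrarily large
    scale, where its cost is negligible. *)

(** * The quadratic B-spline and its square root *)

Section spline.
Context {R : realType}.
Implicit Types x y t : R.

(** The pieces sqrt(3/4 - x^2), (3/2 - |x|)/sqrt 2 and 0 are written with clamps of |x|; each clamp
    is 1-Lipschitz, so the Lipschitz bound needs no case analysis on the pieces. *)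
Definition spline_root x : R :=
  Num.sqrt (3 / 4 - Num.min `|x| (1 / 2) ^+ 2)
  - Num.min (Num.max (`|x| - 1 / 2) 0) 1 / Num.sqrt 2.

Lemma spline_root_mid x : `|x| <= 1 / 2 -> spline_root x ^+ 2 = 3 / 4 - x ^+ 2.
Proof.
move=> x12; rewrite /spline_root (min_idPl x12) (max_idPr _) ?subr_le0//.
rewrite (min_idPl _) ?ler01// mul0r subr0 sqr_sqrtr real_normK ?num_real//.
have : `|x| ^+ 2 <= (1 / 2) ^+ 2 by rewrite lerXn2r ?nnegrE//; lra.
by rewrite real_normK ?num_real//; lra.
Qed.

Lemma sqrt_half : Num.sqrt (1 / 2) = 1 / Num.sqrt 2 :> R.
Proof. by rewrite !mul1r sqrtrV//. Qed.

Lemma spline_root_side x : 1 / 2 <= `|x| <= 3 / 2 ->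
  spline_root x = (3 / 2 - `|x|) / Num.sqrt 2.
Proof.
move=> /andP[x12 x32]; rewrite /spline_root (min_idPr x12) (max_idPl _) ?subr_ge0//.
rewrite (min_idPl _); last lra.
rewrite (_ : 3 / 4 - (1 / 2) ^+ 2 = 1 / 2); last lra.
by rewrite sqrt_half -mulrBl; congr (_ / _); lra.
Qed.

Lemma spline_root_out x : 3 / 2 <= `|x| -> spline_root x = 0.
Proof.
move=> x32; rewrite /spline_root (min_idPr _); last lra.
rewrite (max_idPl _) ?subr_ge0; last lra.
rewrite (min_idPr _); last lra.
rewrite (_ : 3 / 4 - (1 / 2) ^+ 2 = 1 / 2); last lra.
by rewrite sqrt_half subrr.
Qed.

Lemma spline_root_ge0 x : 0 <= spline_root x.
Proof.
have [x32|x32] := leP (3 / 2) `|x|; first by rewrite spline_root_out.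
have [x12|x12] := leP (1 / 2) `|x|.
  rewrite spline_root_side; last by rewrite x12 ltW.
  by rewrite divr_ge0 ?sqrtr_ge0// subr_ge0 ltW.
rewrite /spline_root (max_idPr _) ?subr_le0; last exact: ltW.
by rewrite [Num.min 0 1]min_l ?ler01// mul0r subr0 sqrtr_ge0.
Qed.

Lemma sqr_sqrtrB_le a b : 1 / 2 <= a -> 1 / 2 <= b ->
  (Num.sqrt a - Num.sqrt b) ^+ 2 <= (a - b) ^+ 2 / 2 :> R.
Proof.
move=> a12 b12.
have sa : Num.sqrt a ^+ 2 = a by rewrite sqr_sqrtr//; lra.
have sb : Num.sqrt b ^+ 2 = b by rewrite sqr_sqrtr//; lra.
have sa0 := sqrtr_ge0 a; have sb0 := sqrtr_ge0 b.
rewrite -[in leRHS]sa -[in leRHS]sb subr_sqr exprMn -mulrA ler_peMr ?sqr_ge0//.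
rewrite ler_pdivlMr// mul1r sqrrD sa sb.
have : 1 / 2 <= Num.sqrt a * Num.sqrt b.
  rewrite -sqrtrM; last lra.
  have -> : 1 / 2 = Num.sqrt ((1 / 2) ^+ 2) :> R by rewrite sqrtr_sqr ger0_norm//; lra.
  by rewrite ler_wsqrtr// expr2 ler_pM//; lra.
by lra.
Qed.

Lemma minr_lip a b c : `|Num.min a c - Num.min b c| <= `|a - b| :> R.
Proof.
rewrite !minEle; case: (leP a c) => ?; case: (leP b c) => ? //.
- have := ler_norm (a - b); have := ler_norm (b - a).
  by rewrite (distrC b) ler_norml => ? ?; apply/andP; split; lra.
- have := ler_norm (a - b); have := ler_norm (b - a).
  by rewrite (distrC b) ler_norml => ? ?; apply/andP; split; lra.
- by rewrite subrr normr0.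
Qed.

Lemma maxr_lip a b c : `|Num.max a c - Num.max b c| <= `|a - b| :> R.
Proof.
rewrite !maxEle; case: (leP a c) => ?; case: (leP b c) => ? //.
- by rewrite subrr normr0.
- have := ler_norm (a - b); have := ler_norm (b - a).
  by rewrite (distrC b) ler_norml => ? ?; apply/andP; split; lra.
- have := ler_norm (a - b); have := ler_norm (b - a).
  by rewrite (distrC b) ler_norml => ? ?; apply/andP; split; lra.
Qed.

Lemma spline_root_lip x y :
  (spline_root x - spline_root y) ^+ 2 <= 2 * (x - y) ^+ 2.
Proof.
rewrite /spline_root.
set c : R := Num.min `|x| _; set c' : R := Num.min `|y| _.
set d : R := Num.min _ 1; set d' : R := Num.min _ 1.
have cc : (c - c') ^+ 2 <= (x - y) ^+ 2.
  rewrite -[leLHS]real_normK ?num_real// -[leRHS]real_normK ?num_real//.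
  rewrite lerXn2r ?nnegrE// (le_trans (minr_lip _ _ _))//.
  by rewrite (le_trans (ler_dist_dist _ _)).
have dd : (d - d') ^+ 2 <= (x - y) ^+ 2.
  rewrite -[leLHS]real_normK ?num_real// -[leRHS]real_normK ?num_real//.
  rewrite lerXn2r ?nnegrE// (le_trans (minr_lip _ _ _))//.
  rewrite (le_trans (maxr_lip _ _ _))//.
  rewrite (_ : _ - _ = `|x| - `|y|); last lra.
  by rewrite (le_trans (ler_dist_dist _ _)).
have /andP[c0 c1] : 0 <= c <= 1 / 2 by rewrite /c le_min normr_ge0 ge_min lexx orbT; lra.
have /andP[c'0 c'1] : 0 <= c' <= 1 / 2 by rewrite /c' le_min normr_ge0 ge_min lexx orbT; lra.
have sq : (Num.sqrt (3 / 4 - c ^+ 2) - Num.sqrt (3 / 4 - c' ^+ 2)) ^+ 2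
    <= (x - y) ^+ 2 / 2.
  apply: (le_trans (sqr_sqrtrB_le _ _)); [nra|nra|].
  apply: ler_pM => //; rewrite ?sqr_ge0 ?invr_ge0//; apply: le_trans cc.
  rewrite (_ : 3 / 4 - c ^+ 2 - (3 / 4 - c' ^+ 2) = - ((c - c') * (c + c'))); last ring.
  rewrite sqrrN exprMn ler_piMr ?sqr_ge0// expr_le1 ?addr_ge0//.
  by lra.
set A := Num.sqrt (3 / 4 - c ^+ 2) in sq *; set B := Num.sqrt (_ - _) in sq *.
have s2 : (d / Num.sqrt 2 - d' / Num.sqrt 2) ^+ 2 <= (x - y) ^+ 2 / 2.
  by rewrite -mulrBl exprMn exprVn sqr_sqrtr// ler_wpM2r ?invr_ge0.
move: sq s2; set u := d / _; set v := d' / _ => sq s2.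
rewrite (_ : A - u - (B - v) = (A - B) - (u - v)); last ring.
have := sqr_ge0 ((A - B) + (u - v)).
by move: (A - B) (u - v) sq s2 => a b; nra.
Qed.

(* The squares of [spline_root] are the quadratic B-spline: they sum to 1 over
   the integers and reproduce linear functions. *)
Definition spline x : R := spline_root x ^+ 2.

Lemma spline_ge0 x : 0 <= spline x. Proof. exact: sqr_ge0. Qed.

Lemma spline_out x : 3 / 2 <= `|x| -> spline x = 0.
Proof. by move=> /spline_root_out; rewrite /spline => ->; rewrite expr0n. Qed.

Lemma spline_side x : 1 / 2 <= `|x| <= 3 / 2 -> spline x = (3 / 2 - `|x|) ^+ 2 / 2.
Proof. by move=> x12; rewrite /spline spline_root_side// exprMn exprVn sqr_sqrtr. Qed.

Definition grid_pt (m : nat) (g : 'I_(m.*2.+1)) : R := g%:R - m%:R.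

(** Only the integer k nearest to x and its two neighbours are closer than 3/2 to x or can be; the
    margin 2 keeps all three inside the grid. *)
Lemma sum_grid m x (F : R -> R) : `|x| + 2 <= m%:R ->
  (forall t, 3 / 2 <= `|t - x| -> F t = 0) ->
  exists2 k : R, `|x - k| <= 1 / 2 &
    \sum_(g : 'I_(m.*2.+1)) F (grid_pt g) = F (k - 1) + F k + F (k + 1).
Proof.
move=> xm F0.
have xb : - `|x| <= x <= `|x| by rewrite -ler_norml.
move: xb => /andP[xb1 xb2].
have /truncn_itv : 0 <= x + m%:R + 1 / 2 by lra.
move: (Num.truncn _) => n /andP[n1]; rewrite -(natr1 n) => n2.
have n0 : (1 <= n)%N.
  have : (0:R) < n%:R by lra.
  by rewrite ltr0n.
have n3 : (n.+2 <= m.*2.+1)%N.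
  rewrite ltnS -(ler_nat R) -addnn natrD -(natr1 n); lra.
exists (n%:R - m%:R).
  by rewrite ler_norml; apply/andP; split; lra.
rewrite /grid_pt -(big_mkord xpredT (fun i => F (i%:R - m%:R))).
have n4 : (n.-1 <= n.+2)%N by rewrite (leq_trans (leq_pred _))// -addn2 leq_addr.
rewrite (big_cat_nat _ _ (n := n.-1))//=; last by exact: leq_trans n3.
rewrite (big_cat_nat _ _ (n := n.+2) (m := n.-1))//=.
rewrite big_nat big1 ?add0r; last first.
  move=> i /andP[_ ilt]; apply: F0.
  have : i.+2%:R <= n%:R :> R by rewrite ler_nat -(prednK n0) ltnS.
  rewrite -?(natr1 i.+1) -?(natr1 i) -?(natr1 n.+1) -?(natr1 n) => h.
  by rewrite ler_normr; apply/orP; right; lra.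
rewrite [X in _ + X]big_nat [X in _ + X]big1 ?addr0; last first.
  move=> i /andP[ilt _]; apply: F0.
  have : n.+2%:R <= i%:R :> R by rewrite ler_nat.
  rewrite -?(natr1 i.+1) -?(natr1 i) -?(natr1 n.+1) -?(natr1 n) => h.
  by rewrite ler_normr; apply/orP; left; lra.
case: n n0 {n1 n2 n3 n4} => // n _ /=.
rewrite big_ltn; last by rewrite !ltnS (leq_trans (leqnSn _)).
rewrite big_ltn; last by rewrite ltnS.
rewrite big_ltn // big_geq // addr0 addrA -(natr1 n.+1) -(natr1 n).
by congr (F _ + F _ + F _); ring.
Qed.

Lemma spline3 x k : `|x - k| <= 1 / 2 ->
  [/\ spline (k - 1 - x) = (1 / 2 - (x - k)) ^+ 2 / 2,
      spline (k - x) = 3 / 4 - (x - k) ^+ 2 &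
      spline (k + 1 - x) = (1 / 2 + (x - k)) ^+ 2 / 2].
Proof.
move=> xk; have := xk; rewrite ler_norml => /andP[k1 k2].
have nE : `|k - 1 - x| = 1 + (x - k) by rewrite ler0_norm; lra.
have pE : `|k + 1 - x| = 1 - (x - k) by rewrite ger0_norm; lra.
split.
- by rewrite spline_side nE; [congr (_ ^+ 2 / 2); lra|apply/andP; split; lra].
- by rewrite /spline spline_root_mid; [ring|rewrite distrC].
- by rewrite spline_side pE; [congr (_ ^+ 2 / 2); lra|apply/andP; split; lra].
Qed.

Lemma sum_grid_spline m x : `|x| + 2 <= m%:R ->
  \sum_(g : 'I_(m.*2.+1)) spline (grid_pt g - x) = 1.
Proof.
move=> xm; have [|k xk ->] := @sum_grid m x (fun t => spline (t - x)) xm.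
  by move=> t /spline_out.
by have [-> -> ->] := spline3 xk; field.
Qed.

Lemma sum_grid_spline_mean m x : `|x| + 2 <= m%:R ->
  \sum_(g : 'I_(m.*2.+1)) spline (grid_pt g - x) * (grid_pt g - x) = 0.
Proof.
move=> xm.
have [|k xk ->] := @sum_grid m x (fun t => spline (t - x) * (t - x)) xm.
  by move=> t /spline_out ->; rewrite mul0r.
by have [-> -> ->] := spline3 xk; field.
Qed.

Lemma sum_grid_near m x : `|x| + 2 <= m%:R ->
  \sum_(g : 'I_(m.*2.+1)) (`|grid_pt g - x| < 3 / 2)%R%:R <= 3 :> R.
Proof.
move=> xm.
have [|k xk ->] := @sum_grid m x (fun t => (`|t - x| < 3 / 2)%R%:R) xm.
  by move=> t; rewrite leNgt => /negbTE ->.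
have b1 (b : bool) : b%:R <= 1 :> R by case: b.
by apply: (le_trans (lerD (lerD (b1 _) (b1 _)) (b1 _))); lra.
Qed.

Lemma sum_grid_spline_root m x y : `|x| + 2 <= m%:R -> `|y| + 2 <= m%:R ->
  \sum_(g : 'I_(m.*2.+1))
     (spline_root (grid_pt g - x) - spline_root (grid_pt g - y)) ^+ 2
  <= 12 * (x - y) ^+ 2.
Proof.
move=> xm ym.
pose N z := \sum_(g : 'I_(m.*2.+1)) (`|grid_pt g - z| < 3 / 2)%R%:R : R.
have Nx : N x <= 3 := sum_grid_near xm.
have Ny : N y <= 3 := sum_grid_near ym.
apply: (@le_trans _ _ (2 * (x - y) ^+ 2 * (N x + N y))); last first.
  by have := sqr_ge0 (x - y); nra.
rewrite -big_split mulr_sumr; apply: ler_sum => g _ /=.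
have [gx|gx] := ltP `|grid_pt g - x| (3 / 2); last first.
  have [gy|gy] := ltP `|grid_pt g - y| (3 / 2); last first.
    by rewrite !spline_root_out// subrr expr0n addr0 mulr0.
  rewrite add0r mulr1 (le_trans (spline_root_lip _ _))//.
  by rewrite (_ : _ - _ = - (x - y)) ?sqrrN//; ring.
apply: (@le_trans _ _ (2 * (x - y) ^+ 2)); last first.
  rewrite -[leLHS]mulr1 ler_wpM2l ?(mulr_ge0 _ (sqr_ge0 _))//=.
  by case: ltP => _ /=; lra.
rewrite (le_trans (spline_root_lip _ _))//.
by rewrite (_ : _ - _ = - (x - y)) ?sqrrN//; ring.
Qed.

(** Serves the moment generating function: with x = t u and u centred, the linear term averages out
    and a Gaussian bound remains. The coefficient 2 leaves room for a proof from 1 + x <= exp x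
    alone. *)
Lemma expR_leDx2 x : expR x <= x + expR (2 * x ^+ 2).
Proof.
have e2 := expR_ge1Dx (2 * x ^+ 2).
have [x1|x1] := leP 1 x.
  by rewrite ler_wpDl ?ler_expR; nra.
have [x0|x0] := leP 0 x.
  rewrite (le_trans _ (lerD (lexx x) e2))//.
  (* On [0, 1], exp x = exp(x/2)^2 <= (1 - x/2)^-2; a polynomial inequality remains. *)
  have h := expR_ge1Dx (- (x / 2)).
  rewrite expRN in h.
  have p : 0 < expR (x / 2) := expR_gt0 _.
  have -> : expR x = expR (x / 2) ^+ 2.
    by rewrite expr2 -expRD; congr expR; lra.
  move: h; rewrite -(ler_pM2l p) divff ?gt_eqF// => h.
  move: (expR _) p h => e p h.
  have e12 : e ^+ 2 * (1 - x / 2) ^+ 2 <= 1.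
    by rewrite -exprMn expr_le1//; nra.
  have x2 : 1 <= (x + (1 + 2 * x ^+ 2)) * (1 - x / 2) ^+ 2.
    rewrite -subr_ge0 (_ : _ - 1 = x ^+ 2 * (1 - x) * (5 / 2 - x) / 2); last by field.
    by rewrite divr_ge0// !mulr_ge0 ?sqr_ge0//; lra.
  have pos : 0 < (1 - x / 2) ^+ 2 by rewrite exprn_gt0//; lra.
  by rewrite -(ler_pM2r pos) (le_trans e12).
have [x1'|x1'] := leP x (- 1).
  have : expR x <= 1 by rewrite -expR0 ler_expR ltW.
  by nra.
have h := expR_ge1Dx (- x).
rewrite expRN in h.
have p : 0 < expR x := expR_gt0 _.
rewrite (le_trans _ (lerD (lexx x) e2))//.
move: h; rewrite -(ler_pM2l p) divff ?gt_eqF// => h.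
have pos : 0 < 1 - x by lra.
rewrite -(ler_pM2r pos) (le_trans h)//; nra.
Qed.

(** Apply [expR_leDx2] termwise, then mean zero and total mass 1; 9/2 is 2 (3/2)^2, from the
    half-width 3/2 of the spline. *)
Lemma sum_grid_expR m x t : `|x| + 2 <= m%:R ->
  \sum_(g : 'I_(m.*2.+1)) spline (grid_pt g - x) * expR (t * (grid_pt g - x))
  <= expR (9 / 2 * t ^+ 2).
Proof.
move=> xm.
apply: (@le_trans _ _ (\sum_(g : 'I_(m.*2.+1))
   (t * (spline (grid_pt g - x) * (grid_pt g - x))
    + expR (9 / 2 * t ^+ 2) * spline (grid_pt g - x)))); last first.
  rewrite big_split/= -!mulr_sumr.
  by rewrite sum_grid_spline_mean// sum_grid_spline// mulr0 add0r mulr1.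
apply: ler_sum => g _.
have [gx|gx] := leP (3 / 2) `|grid_pt g - x|.
  by rewrite spline_out// !mul0r !mulr0 addr0.
move: gx; move: (grid_pt g - x) => u gx.
rewrite mulrCA (mulrC (expR _)) -mulrDr ler_wpM2l ?spline_ge0//.
rewrite (le_trans (expR_leDx2 _))// lerD2l ler_expR.
have : u ^+ 2 <= (3 / 2) ^+ 2.
  by rewrite -[leLHS]real_normK ?num_real// lerXn2r// ?nnegrE//; lra.
rewrite exprMn; have := sqr_ge0 t; nra.
Qed.

End spline.

(** * Distance of labelled weights, and normalisation *)

Section labelled_distance.
Context {R : realType}.

(* Distance between the point masses [u] and [v] of two measures, sitting on
   the same atom or on different atoms. *)
Definition ldist (same : bool) (u v : R) : R := if same then `|u - v| else u + v.

Lemma ldist_ge0 s u v : 0 <= u -> 0 <= v -> 0 <= ldist s u v.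
Proof. by move=> u0 v0; rewrite /ldist; case: s; rewrite ?addr_ge0. Qed.

Lemma normB_ldist s u v : 0 <= u -> 0 <= v -> `|u - v| <= ldist s u v.
Proof.
move=> u0 v0; rewrite /ldist; case: s => //.
by rewrite (le_trans (ler_normB _ _))// !ger0_norm.
Qed.

(** Since c/C - c/B = c (B - C)/(B C), changing the normaliser costs |B - C|/B <= L/beta in total;
    the difference of the unnormalised weights costs as much again. *)
Lemma ldist_normalize (I : finType) (s : pred I) (b c : I -> R) (beta L : R) :
    0 < beta -> (forall i, 0 <= b i) -> (forall i, 0 <= c i) ->
    beta <= \sum_i b i -> beta <= \sum_i c i ->
    \sum_i ldist (s i) (b i) (c i) <= L ->
  \sum_i ldist (s i) (b i / \sum_j b j) (c i / \sum_j c j) <= 2 * L / beta.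
Proof.
move=> beta0 b0 c0 bB cC DL.
set B := \sum_i b i in bB *; set C := \sum_i c i in cC *.
have B0 : 0 < B by apply: lt_le_trans bB.
have C0 : 0 < C by apply: lt_le_trans cC.
have BC : `|B - C| <= L.
  rewrite -sumrB (le_trans (ler_norm_sum _ _ _))// (le_trans _ DL)//.
  by apply: ler_sum => i _; apply: normB_ldist.
have L0 : 0 <= L := le_trans (normr_ge0 _) BC.
apply: (@le_trans _ _ (\sum_i (ldist (s i) (b i) (c i) / B + c i * (`|B - C| / (B * C))))).
  apply: ler_sum => i _.
  have cE : c i / C = c i / B + c i * ((B - C) / (B * C)).
    by field; rewrite !gt_eqF.
  have cN : c i * ((B - C) / (B * C)) <= c i * (`|B - C| / (B * C)).
    by rewrite ler_wpM2l// ler_pM2r ?ler_norm// invr_gt0 mulr_gt0.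
  rewrite /ldist; case: (s i); last first.
    by rewrite cE [in leRHS]mulrDl addrA lerD2l.
  rewrite cE opprD addrA -mulrBl (le_trans (ler_normB _ _))// lerD//.
    by rewrite normrM (@ger0_norm _ B^-1)// invr_ge0 ltW.
  by rewrite !normrM (ger0_norm (c0 i)) normfV (@ger0_norm _ (B * C))// mulr_ge0// ltW.
rewrite big_split/= -!mulr_suml -/C.
have -> : C * (`|B - C| / (B * C)) = `|B - C| / B by field; rewrite !gt_eqF.
rewrite -mulrDl ler_pM ?invr_ge0//.
- by rewrite addr_ge0// sumr_ge0// => i _; apply: ldist_ge0.
- exact: ltW.
- by rewrite mulr_natl mulr2n lerD.
- by rewrite lef_pV2.
Qed.

End labelled_distance.

(** * Random rounding to the integer grid *)

Section product_weights.
Context {R : realType} (k m : nat).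
Implicit Types a b d : 'I_k -> R.
Local Notation grid := {ffun 'I_k -> 'I_(m.*2.+1)}.

Definition in_box a := forall i, `|a i| + 2 <= m%:R.

Definition weight_root a (Y : grid) : R :=
  \prod_i spline_root (grid_pt (Y i) - a i).

(** The law of the rounding of a: independent coordinates, each distributed by the B-spline centred
    at [a i]. *)
Definition weight a (Y : grid) : R := \prod_i spline (grid_pt (Y i) - a i).

Lemma weight_ge0 a Y : 0 <= weight a Y.
Proof. by rewrite prodr_ge0// => i _; apply: spline_ge0. Qed.

Lemma weightE a Y : weight a Y = weight_root a Y ^+ 2.
Proof. by rewrite -prodrXl. Qed.

Lemma sum_weight a : in_box a -> \sum_Y weight a Y = 1.
Proof.
move=> am; rewrite -(bigA_distr_bigA (fun i g => spline (grid_pt g - a i)))/=.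
by rewrite big1// => i _; apply: sum_grid_spline.
Qed.

(* Hellinger distance is subadditive over products. *)
Lemma sum_weight_root a b : in_box a -> in_box b ->
  \sum_Y (weight_root a Y - weight_root b Y) ^+ 2
  <= 12 * \sum_i (a i - b i) ^+ 2.
Proof.
move=> am bm.
pose rho i := \sum_(g : 'I_(m.*2.+1))
  spline_root (grid_pt g - a i) * spline_root (grid_pt g - b i).
have rhoE i : 2 * (1 - rho i) = \sum_(g : 'I_(m.*2.+1))
    (spline_root (grid_pt g - a i) - spline_root (grid_pt g - b i)) ^+ 2.
  under eq_bigr do rewrite sqrrB.
  rewrite big_split/= sumrB sumrMnl.
  have -> := sum_grid_spline (am i); have -> := sum_grid_spline (bm i).
  by rewrite -/(rho i); ring.
have rho01 i : 0 <= rho i <= 1.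
  apply/andP; split.
    by rewrite sumr_ge0// => g _; rewrite mulr_ge0 ?spline_root_ge0.
  rewrite -subr_ge0 -(@pmulr_rge0 _ 2)// rhoE sumr_ge0// => g _.
  exact: sqr_ge0.
have -> : \sum_Y (weight_root a Y - weight_root b Y) ^+ 2
    = 2 * (1 - \prod_i rho i).
  rewrite (eq_bigr (fun Y => weight a Y -
      (weight_root a Y * weight_root b Y) *+ 2 + weight b Y)); last first.
    by move=> Y _; rewrite sqrrB -!weightE.
  rewrite big_split/= sumrB sumrMnl !sum_weight//.
  have -> : \sum_Y weight_root a Y * weight_root b Y = \prod_i rho i.
    rewrite /rho bigA_distr_bigA; apply: eq_bigr => Y _.
    by rewrite /weight_root -big_split.
  by ring.
(* Weierstrass product inequality; the bounds on the product are carried along for the induction. *)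
have : 1 - \sum_i (1 - rho i) <= \prod_i rho i /\ 0 <= \prod_i rho i <= 1.
  elim/big_ind2: _ => [|p q p' q' [h1 /andP[h2 h3]] [h4 /andP[h5 h6]]|i _].
  - by rewrite subr0 lexx ler01.
  - rewrite mulr_ge0// mulr_ile1//; split=> //; nra.
  - by rewrite opprB addrC subrK lexx.
move=> [h _].
apply: (@le_trans _ _ (\sum_i 2 * (1 - rho i))).
  by rewrite -mulr_sumr ler_pM2l//; lra.
rewrite mulr_sumr; apply: ler_sum => i _.
by rewrite rhoE sum_grid_spline_root.
Qed.

(** From |s^2 - t^2| = |s - t| |s + t| and a weighted arithmetic-geometric mean: the squared
    differences sum to at most 12 D^2, the squared sums to at most 4, which gives 6 D + 2 D. *)
Lemma sum_weight_lip a b D : in_box a -> in_box b -> 0 < D ->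
  \sum_i (a i - b i) ^+ 2 <= D ^+ 2 ->
  \sum_Y `|weight a Y - weight b Y| <= 8 * D.
Proof.
move=> am bm D0 abD.
pose u Y := weight_root a Y - weight_root b Y.
pose v Y := weight_root a Y + weight_root b Y.
apply: (@le_trans _ _ (\sum_Y (u Y ^+ 2 / (2 * D) + D / 2 * v Y ^+ 2))).
  apply: ler_sum => Y _.
  rewrite !weightE subr_sqr -/(u Y) -/(v Y) normrM -[u Y ^+ 2]real_normK ?num_real//.
  rewrite -[v Y ^+ 2]real_normK ?num_real//.
  move: `|u Y| `|v Y| => x y; rewrite -subr_ge0.
  rewrite (_ : _ - _ = (x - D * y) ^+ 2 / (2 * D)).
    by rewrite divr_ge0 ?sqr_ge0// mulr_ge0// ltW.
  by field; rewrite gt_eqF.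
rewrite big_split/= -mulr_suml -mulr_sumr.
have uD : \sum_Y u Y ^+ 2 <= 12 * D ^+ 2.
  by rewrite (le_trans (sum_weight_root am bm))// ler_wpM2l.
have vD : \sum_Y v Y ^+ 2 <= 4.
  apply: (@le_trans _ _ (\sum_Y (2 * weight a Y + 2 * weight b Y))).
    apply: ler_sum => Y _; rewrite !weightE /v.
    by have := sqr_ge0 (weight_root a Y - weight_root b Y); nra.
  by rewrite big_split/= -!mulr_sumr !sum_weight//; lra.
apply: (@le_trans _ _ (12 * D ^+ 2 / (2 * D) + D / 2 * 4)).
  apply: lerD; first by rewrite ler_wpM2r// invr_ge0; lra.
  by rewrite ler_wpM2l//; lra.
by rewrite le_eqVlt; apply/orP; left; apply/eqP; field; rewrite gt_eqF.
Qed.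

Lemma weight_tail a d t : in_box a -> 0 < \sum_i d i ^+ 2 -> 0 <= t ->
  \sum_(Y : grid | t <= \sum_i d i * (grid_pt (Y i) - a i)) weight a Y
  <= expR (- (t ^+ 2 / (18 * \sum_i d i ^+ 2))).
Proof.
move=> am; set d2 := \sum_i d i ^+ 2 => d20 t0.
(* Chernoff parameter: the minimiser of -l t + (9/2) l^2 d2, with minimum -t^2/(18 d2). *)
pose l := t / (9 * d2).
have l0 : 0 <= l by rewrite divr_ge0// mulr_ge0// ltW.
apply: (@le_trans _ _ (\sum_(Y : grid) expR (- (l * t)) *
   \prod_i (spline (grid_pt (Y i) - a i) *
     expR (l * d i * (grid_pt (Y i) - a i))))).
  rewrite big_mkcond; apply: ler_sum => Y _.
  have w0 := weight_ge0 a Y.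
  rewrite big_split/= -/(weight a Y) -expR_sum.
  case: ifP => [tY|_]; last by rewrite !mulr_ge0 ?expR_ge0.
  rewrite mulrCA -expRD ler_peMr// -expR0 ler_expR.
  under eq_bigr do rewrite -mulrA.
  by rewrite -mulr_sumr addrC subr_ge0 ler_wpM2l.
rewrite -mulr_sumr.
rewrite -(bigA_distr_bigA (fun i g => spline (grid_pt g - a i) *
     expR (l * d i * (grid_pt g - a i))))/=.
apply: (@le_trans _ _ (expR (- (l * t)) * \prod_i expR (9 / 2 * (l * d i) ^+ 2))).
  rewrite ler_wpM2l ?expR_ge0// ler_prod// => i _.
  rewrite sum_grid_expR// sumr_ge0// => g _.
  by rewrite mulr_ge0 ?expR_ge0 ?spline_ge0.
rewrite -expR_sum -expRD ler_expR.
under eq_bigr do rewrite exprMn mulrA.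
rewrite -mulr_sumr -/d2 /l.
by rewrite le_eqVlt; apply/orP; left; apply/eqP; field; rewrite gt_eqF.
Qed.

End product_weights.

(** * Decoding to the nearest point *)

Section decoding.
Context {R : realType} (k m n : nat) (b : 'I_n.+1 -> 'I_k -> R).
Local Notation grid := {ffun 'I_k -> 'I_(m.*2.+1)}.

Definition sqdist (a c : 'I_k -> R) : R := \sum_i (a i - c i) ^+ 2.

Definition decode (Y : grid) : 'I_n.+1 :=
  [arg min_(j < ord0) sqdist (fun i => grid_pt (Y i)) (b j)]%O.

Definition decode_prob (a : 'I_k -> R) (j : 'I_n.+1) : R :=
  \sum_(Y : grid | decode Y == j) weight a Y.

Lemma sum_decode_prob a : in_box m a -> \sum_j decode_prob a j = 1.
Proof.
move=> am; rewrite -(sum_weight am) (partition_big decode xpredT)//.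
Qed.

Lemma decode_prob_lip a c D : in_box m a -> in_box m c -> 0 < D ->
  sqdist a c <= D ^+ 2 -> \sum_j `|decode_prob a j - decode_prob c j| <= 8 * D.
Proof.
move=> am cm D0 acD; apply: le_trans (sum_weight_lip am cm D0 acD).
rewrite [leRHS](partition_big decode xpredT)//; apply: ler_sum => j _.
by rewrite -sumrB ler_norm_sum.
Qed.

(** If Y decodes to j, it is at least as near to [b j] as to [b i], so the inner product of the
    rounding error with [b j - b i] is at least an eighth of their squared distance. In the tail
    bound, 1152 = 18 times 8^2. *)
Lemma decode_prob_far a i j : in_box m a ->
  0 < sqdist (b j) (b i) -> 8 * sqdist a (b i) <= sqdist (b j) (b i) ->
  decode_prob a j <= expR (- (sqdist (b j) (b i) / 1152)).
Proof.
move=> am D0 aD; set D2 := sqdist (b j) (b i) in D0 aD *.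
have D80 : 0 <= D2 / 8 by rewrite divr_ge0// ltW.
have := weight_tail am D0 D80.
rewrite -/(sqdist (b j) (b i)) -/D2.
rewrite (_ : (D2 / 8) ^+ 2 / (18 * D2) = D2 / 1152); last first.
  by field; rewrite gt_eqF.
apply: le_trans; rewrite /decode_prob big_mkcond [leRHS]big_mkcond.
apply: ler_sum => Y _; case: eqP => [Yj|_]; last first.
  by case: ifP => // _; apply: weight_ge0.
rewrite ifT//.
have : sqdist (fun l => grid_pt (Y l)) (b j) <= sqdist (fun l => grid_pt (Y l)) (b i).
  by rewrite -Yj /decode; case: arg_minP => // i' _; apply.
set y := fun l => grid_pt (Y l); set S := \sum_l _.
have h : 2^-1 * D2 - 2 * sqdist a (b i) + - 2 * S <=
    sqdist y (b j) - sqdist y (b i).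
  rewrite /D2 /S /sqdist !mulr_sumr -!sumrB -big_split/=.
  by apply: ler_sum => l _; rewrite /y; move: (grid_pt (Y l)) => z;
     have := sqr_ge0 (2 * a l - b j l - b i l); nra.
by lra.
Qed.

(** Cutting every probability by 1/(2N), with N = [n.+1], kills the labels at squared distance
    beyond T and removes at most half of the mass. Renormalising costs the factor 4 that turns 8 D
    into 32 D. *)
Lemma decoding_partition (T : R) : 1152 * ln (2 * n.+1%:R) <= T ->
  exists phi : ('I_k -> R) -> 'I_n.+1 -> R,
  [/\ forall a j, 0 <= phi a j,
      forall a, in_box m a -> \sum_j phi a j = 1,
      forall a i j, in_box m a -> 8 * sqdist a (b i) <= T ->
        0 < phi a j -> sqdist (b j) (b i) <= T &
      forall a c D, in_box m a -> in_box m c -> 0 < D ->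
        sqdist a c <= D ^+ 2 -> \sum_j `|phi a j - phi c j| <= 32 * D].
Proof.
move=> lnT.
have n1 : 1 <= n.+1%:R :> R by rewrite ler1n.
have T0 : 0 < T.
  by apply: lt_le_trans lnT; apply: mulr_gt0; [rewrite ltr0n|rewrite ln_gt0; lra].
pose theta a j := Num.max (decode_prob a j - (2 * n.+1%:R)^-1) 0.
have theta0 a j : 0 <= theta a j by rewrite le_max lexx orbT.
have theta2 a : in_box m a -> 2^-1 <= \sum_j theta a j.
  move=> am; apply: (@le_trans _ _
      (\sum_(j < n.+1) (decode_prob a j - (2 * n.+1%:R)^-1))).
    rewrite sumrB sum_decode_prob// sumr_const card_ord -mulr_natr.
    by rewrite le_eqVlt; apply/orP; left; apply/eqP; field; lra.
  by apply: ler_sum => j _; rewrite le_max lexx.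
exists (fun a j => theta a j / \sum_l theta a l); split.
- by move=> a j; rewrite divr_ge0// sumr_ge0.
- move=> a am; rewrite -mulr_suml divff// lt0r_neq0//.
  by apply: lt_le_trans (theta2 _ am); rewrite invr_gt0 ltr0n.
- move=> a i j am aT; apply: contraTT; rewrite -ltNge => TD.
  rewrite -leNgt (_ : theta a j = 0) ?mul0r//.
  apply/max_idPr; rewrite subr_le0.
  rewrite (le_trans (decode_prob_far am (lt_trans T0 TD) _))//.
    by rewrite (le_trans aT)// ltW.
  rewrite -[leRHS]lnK ?posrE ?invr_gt0 ?mulr_gt0// ler_expR lnV ?posrE ?mulr_gt0//.
  rewrite lerN2 ler_pdivlMr; last by rewrite ltr0n.
  by rewrite mulrC; exact: le_trans lnT (ltW TD).
- move=> a c D am cm D0 acD.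
  have := @ldist_normalize R _ xpredT (theta a) (theta c) 2^-1 (8 * D) _
    (theta0 a) (theta0 c) (theta2 a am) (theta2 c cm).
  rewrite invrK (_ : 2 * (8 * D) * 2 = 32 * D); last ring.
  apply; first by rewrite invr_gt0.
  apply: le_trans (decode_prob_lip am cm D0 acD); apply: ler_sum => j _.
  rewrite /ldist /theta (le_trans (maxr_lip _ _ _))//.
  by rewrite opprB addrA subrK.
Qed.

End decoding.

(** * Gram-Schmidt for a semidefinite form, and Hilbert space partitions *)

Section gram_schmidt.
Context {R : realType} (V : lmodType R) (P : V -> Prop) (B : V -> V -> R).
Hypothesis P0 : P 0.
Hypothesis Plin : forall a u v, P u -> P v -> P (a *: u + v).
Hypothesis Bsym : forall u v, B u v = B v u.
Hypothesis Blin : forall a u v w, P u -> P v -> P w ->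
  B (a *: u + v) w = a * B u w + B v w.
Hypothesis Bge0 : forall u, P u -> 0 <= B u u.

Let PZ a u : P u -> P (a *: u).
Proof. by move=> Pu; rewrite -[_ *: _]addr0; apply: Plin. Qed.

Let PD u v : P u -> P v -> P (u + v).
Proof. by move=> Pu Pv; rewrite -[u]scale1r; apply: Plin. Qed.

Let PB u v : P u -> P v -> P (u - v).
Proof. by move=> Pu Pv; rewrite addrC -scaleN1r; apply: Plin. Qed.

Let Psum k (F : 'I_k -> V) : (forall i, P (F i)) -> P (\sum_i F i).
Proof. by move=> PF; elim/big_ind: _ => //; apply: PD. Qed.

Let B0 w : P w -> B 0 w = 0.
Proof.
move=> Pw; have := Blin 1 P0 P0 Pw; rewrite scale1r addr0 mul1r => /eqP.
by rewrite -subr_eq0 opprD addrA subrr add0r oppr_eq0 => /eqP.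
Qed.

Let BZ a u w : P u -> P w -> B (a *: u) w = a * B u w.
Proof. by move=> Pu Pw; rewrite -[_ *: _]addr0 Blin// B0// addr0. Qed.

Let BD u v w : P u -> P v -> P w -> B (u + v) w = B u w + B v w.
Proof. by move=> Pu Pv Pw; rewrite -[u]scale1r Blin// mul1r scale1r. Qed.

Let BB u v w : P u -> P v -> P w -> B (u - v) w = B u w - B v w.
Proof. by move=> Pu Pv Pw; rewrite addrC -scaleN1r Blin// mulN1r addrC. Qed.

Let Bsum k (F : 'I_k -> V) w : (forall i, P (F i)) -> P w ->
  B (\sum_i F i) w = \sum_i B (F i) w.
Proof.
move=> PF Pw.
suff [] : P (\sum_i F i) /\ B (\sum_i F i) w = \sum_i B (F i) w by [].
elim/big_rec2: _ => [|i u r _ [Pr <-]]; first by rewrite B0.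
by split; [exact: PD|rewrite BD].
Qed.

Definition orthonormal k (e : nat -> V) :=
  (forall i, (i < k)%N -> P (e i)) /\
  (forall i j, (i < k)%N -> (j < k)%N -> B (e i) (e j) = (i == j)%:R).

Definition residue k (e : nat -> V) u := u - \sum_(i < k) B u (e i) *: e i.

Section residue.
Variables (k : nat) (e : nat -> V).
Hypothesis on_e : orthonormal k e.

Let Pe i : (i < k)%N -> P (e i). Proof. exact: on_e.1. Qed.

Let BZe a i w : (i < k)%N -> P w -> B (a *: e i) w = a * B (e i) w.
Proof. by move=> ik Pw; apply: BZ => //; apply: Pe. Qed.

Let Bee a i j : (i < k)%N -> (j < k)%N -> B (a *: e i) (e j) = a * (i == j)%:R.
Proof. by move=> ik jk; rewrite BZe ?on_e.2//; apply: Pe. Qed.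

Lemma residue_closed u : P u -> P (residue k e u).
Proof. by move=> Pu; apply: PB => //; apply: Psum => i; apply/PZ/Pe. Qed.

Lemma residue_orth u j : (j < k)%N -> P u -> B (residue k e u) (e j) = 0.
Proof.
move=> jk Pu; rewrite /residue BB ?Bsum//; last 4 first.
- by move=> i; apply/PZ/Pe.
- exact: Pe.
- by apply: Psum => i; apply/PZ/Pe.
- exact: Pe.
rewrite (bigD1 (Ordinal jk))//= big1 => [|i ij].
  by rewrite Bee// eqxx mulr1 addr0 subrr.
rewrite Bee//; case: eqP => [ij'|]; last by rewrite mulr0.
by case/eqP: ij; apply: val_inj.
Qed.

Lemma residue_self u : P u ->
  B (residue k e u) (residue k e u) = B u (residue k e u).
Proof.
move=> Pu; have Pr := residue_closed Pu.
have Ps : P (\sum_(i < k) B u (e i) *: e i) by apply: Psum => i; apply/PZ/Pe.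
rewrite {1}/residue BB// [X in _ - X](_ : _ = 0) ?subr0//.
  rewrite Bsum//; last by move=> i; apply/PZ/Pe.
  by rewrite big1// => i _; rewrite BZe// [B (e _) _]Bsym residue_orth ?mulr0.
Qed.

Lemma residue_sqr u : P u ->
  B (residue k e u) (residue k e u) = B u u - \sum_(i < k) B u (e i) ^+ 2.
Proof.
move=> Pu; have Pr := residue_closed Pu.
have Ps : P (\sum_(i < k) B u (e i) *: e i) by apply: Psum => i; apply/PZ/Pe.
rewrite residue_self// Bsym /residue BB// Bsum//; last by move=> i; apply/PZ/Pe.
by congr (_ - _); apply: eq_bigr => i _; rewrite BZe// [B (e _) _]Bsym.
Qed.

Lemma bessel u : P u -> \sum_(i < k) B u (e i) ^+ 2 <= B u u.
Proof. by move=> Pu; rewrite -subr_ge0 -residue_sqr//; apply/Bge0/residue_closed. Qed.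

End residue.

(** The form may be degenerate: a residue of norm zero is dropped, as Parseval's identity then
    already holds. Otherwise it is normalised and appended, and Bessel's inequality preserves the
    earlier identities. *)
Lemma gram_schmidt (y : nat -> V) n : (forall j, (j < n)%N -> P (y j)) ->
  exists k e, orthonormal k e /\ forall j, (j < n)%N ->
    B (y j) (y j) = \sum_(i < k) B (y j) (e i) ^+ 2.
Proof.
elim: n => [_|n IH Py]; first by exists 0, (fun=> 0); split => //; split.
have [j jn|k [e [one ye]]] := IH; first by apply: Py; exact: ltnW.
have Pn : P (y n) by exact: Py.
pose r := residue k e (y n); have Pr : P r by apply: residue_closed.
have rE : B r r = B (y n) (y n) - \sum_(i < k) B (y n) (e i) ^+ 2.
  exact: residue_sqr.
have [r0|r0] := eqVneq (B r r) 0.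
  exists k, e; split=> // j; rewrite ltnS leq_eqVlt => /predU1P[->|]; last exact: ye.
  by apply/eqP; rewrite -subr_eq0 -rE r0.
have {r0} r0 : 0 < B r r by rewrite lt_neqAle eq_sym r0 Bge0.
pose c := Num.sqrt (B r r).
have c0 : 0 < c by rewrite sqrtr_gt0.
have cE : c ^+ 2 = B r r by rewrite sqr_sqrtr// ltW.
pose e' i := if i == k then c^-1 *: r else e i.
have e'k : e' k = c^-1 *: r by rewrite /e' eqxx.
have e'l i : (i < k)%N -> e' i = e i by rewrite /e'; case: ltngtP.
have re i : (i < k)%N -> B r (e i) = 0 by move=> ik; apply: residue_orth.
have Pe i : (i < k)%N -> P (e i) by apply: one.1.
have one' : orthonormal k.+1 e'.
  split=> [i|i j]; rewrite !ltnS.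
    by rewrite leq_eqVlt => /predU1P[->|ik]; rewrite ?e'k ?e'l//; [apply: PZ|apply: Pe].
  rewrite (leq_eqVlt i) (leq_eqVlt j) => /predU1P[->|ik] /predU1P[->|jk].
  - rewrite e'k BZ//; last exact: PZ.
    by rewrite Bsym BZ// -cE eqxx /=; field; rewrite gt_eqF.
  - rewrite e'k e'l// BZ//; last exact: Pe.
    by rewrite re// mulr0 gtn_eqF.
  - rewrite e'k e'l// Bsym BZ//; last exact: Pe.
    by rewrite re// mulr0 ltn_eqF.
  - by rewrite !e'l// one.2.
exists k.+1, e'; split=> // j; rewrite ltnS leq_eqVlt => /predU1P[->|jn].
  rewrite big_ord_recr/= e'k.
  under eq_bigr do rewrite e'l//.
  apply/eqP; rewrite addrC -subr_eq -rE [B _ (c^-1 *: r)]Bsym BZ//.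
  rewrite [B r (y n)]Bsym -residue_self// -/r -cE; apply/eqP.
  by field; rewrite gt_eqF.
apply/eqP; rewrite eq_le (bessel one') ?andbT; last by apply: Py; exact: ltnW.
rewrite ye// big_ord_recr/=.
under [in leRHS]eq_bigr do rewrite e'l//.
by rewrite lerDl sqr_ge0.
Qed.

(** Orthonormalising all differences [y i - y j], enumerated by quotient and remainder modulo
    [n.+1], makes Parseval exact on them; Bessel gives the contraction elsewhere. *)
Lemma hilbert_coordinates n (y : 'I_n.+1 -> V) : (forall j, P (y j)) ->
  exists k (A : V -> 'I_k -> R),
  [/\ forall u v, P u -> P v -> sqdist (A u) (A v) <= B (u - v) (u - v),
      forall i j, sqdist (A (y i)) (A (y j)) = B (y i - y j) (y i - y j) &
      forall u i, P u -> A u i ^+ 2 <= B u u].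
Proof.
move=> Py; pose z l : V := y (inord (l %/ n.+1)) - y (inord (l %% n.+1)).
have Pz l : P (z l) by apply: PB.
have [k [e [one ze]]] := @gram_schmidt z (n.+1 * n.+1)%N (fun l _ => Pz l).
have Pe (i : 'I_k) : P (e i) by apply: one.1.
exists k, (fun u i => B u (e i)).
have AB u v : P u -> P v -> sqdist (fun i : 'I_k => B u (e i)) (fun i => B v (e i)) =
    \sum_(i < k) B (u - v) (e i) ^+ 2.
  by move=> Pu Pv; apply: eq_bigr => i _; rewrite BB.
split=> [u v Pu Pv|i j|u i Pu].
- by rewrite AB// bessel//; apply: PB.
- have zE : z (i * n.+1 + j)%N = y i - y j.
    rewrite /z divnMDl// divn_small// addn0 modnMDl modn_small//.
    by rewrite !inord_val.
  rewrite AB// -zE ze//.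
  have : (i * n.+1 + j < i.+1 * n.+1)%N by rewrite mulSn addnC ltn_add2r.
  by move=> /leq_trans; apply; rewrite leq_mul2r ltn_ord orbT.
- rewrite (le_trans _ (bessel one Pu))// (bigD1 i)//= lerDl sumr_ge0// => l _.
  exact: sqr_ge0.
Qed.

(** Dilating the coordinates by K = sqrt(T/d2) turns the distance sqrt d2 into the decoding radius
    sqrt T; K then enters the Lipschitz constant. *)
Lemma hilbert_partition n (y : 'I_n.+1 -> V) (d2 : R) : (forall j, P (y j)) ->
  0 < d2 ->
  exists phi : V -> 'I_n.+1 -> R,
  [/\ forall u j, 0 <= phi u j,
      forall u, P u -> B u u <= 1 -> \sum_j phi u j = 1,
      forall u i j, P u -> B u u <= 1 -> 8 * B (u - y i) (u - y i) <= d2 ->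
        0 < phi u j -> B (y j - y i) (y j - y i) <= d2 &
      forall u v D, P u -> B u u <= 1 -> P v -> B v v <= 1 -> 0 < D ->
        B (u - v) (u - v) <= D ^+ 2 ->
        \sum_j `|phi u j - phi v j| <=
          32 * (D * Num.sqrt (1152 * ln (2 * n.+1%:R) / d2))].
Proof.
move=> Py d20; set T := 1152 * _; set K := Num.sqrt _.
have n1 : 1 <= n.+1%:R :> R by rewrite ler1n.
have T0 : 0 < T by apply: mulr_gt0; [rewrite ltr0n|rewrite ln_gt0; lra].
have lnT : 1152 * ln (2 * n.+1%:R) <= T by exact: lexx.
move: T T0 lnT @K => T T0 lnT K.
have K0 : 0 < K by rewrite sqrtr_gt0 divr_gt0.
have K2 : K ^+ 2 = T / d2 by rewrite sqr_sqrtr// ltW// divr_gt0.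
have [k [A [Alip Aiso Ab]]] := hilbert_coordinates Py.
have sqK a c : sqdist (fun i : 'I_k => K * a i) (fun i => K * c i) = K ^+ 2 * sqdist a c.
  by rewrite /sqdist mulr_sumr; apply: eq_bigr => i _; rewrite -mulrBr exprMn.
(* Dilated coordinates of the unit ball are at most K; [in_box] asks for 2 more. *)
pose m := (Num.truncn K).+3.
have Km : K + 2 <= m%:R.
  by have := truncnS_gt K; rewrite /m -(natr1 _.+2) -(natr1 _.+1); lra.
have box u : P u -> B u u <= 1 -> in_box m (fun i => K * A u i).
  move=> Pu u1 i; rewrite (le_trans _ Km)// lerD2r normrM gtr0_norm// ger_pMr//.
  have : A u i ^+ 2 <= 1 by apply: le_trans u1; apply: Ab.
  by rewrite -[leLHS]real_normK ?num_real// expr_le1.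
have [phi [phi0 phi1 phis phil]] :=
  @decoding_partition R k m n (fun j i => K * A (y j) i) T lnT.
exists (fun u => phi (fun i => K * A u i)); split.
- by move=> u j.
- by move=> u Pu u1; apply/phi1/box.
- move=> u i j Pu u1 ud pj.
  have TE c : T / d2 * c = T * (c / d2) by rewrite mulrAC mulrA.
  have h : 8 * sqdist (fun l => K * A u l) (fun l => K * A (y i) l) <= T.
    rewrite sqK K2 TE mulrCA mulrA -[leRHS]mulr1 -mulrA ler_pM2l//.
    rewrite mulrA ler_pdivrMr// mul1r (le_trans _ ud)// ler_pM2l//.
    by apply: Alip.
  have := phis _ i j (box u Pu u1) h pj.
  by rewrite sqK Aiso K2 TE ger_pMr// ler_pdivrMr// mul1r.
- move=> u v D Pu u1 Pv v1 D0 uvD; rewrite mulrA -mulrA (mulrC D).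
  apply: phil => //; [exact: box|exact: box|exact: mulr_gt0|].
  rewrite sqK exprMn ler_pM2l ?exprn_gt0// (le_trans _ uvD)//; exact: Alip.
Qed.

End gram_schmidt.

(** * Partitions of unity and their refinement *)

Section gentle.
Context {R : realType} {M : metricType R}.
Implicit Types (S : set M) (r L : R) (x y z : M).

(* A partition of unity indexed by the pairs [(i, l)], where the only nonzero weight
   at [x] among the [(i, l)] with [i] fixed is [psi i x], at [l = lab i x]; it is
   [L]-Lipschitz in l_1 and its supports have radius at most [r]. *)
Definition gentle S r L : Prop :=
  exists (I : finType) (psi : I -> M -> R) (lab : I -> M -> nat)
      (ctr : I -> nat -> M),
    [/\ forall i x, S x -> 0 <= psi i x,
        forall x, S x -> \sum_i psi i x = 1,
        forall i x, S x -> 0 < psi i x -> mdist x (ctr i (lab i x)) <= r &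
        forall x y, S x -> S y ->
          \sum_i ldist (lab i x == lab i y) (psi i x) (psi i y) <= L * mdist x y].

(** Splits a single cluster into finitely many pieces, so no labels are needed; n is prescribed
    because all clusters must use the same index set. *)
Definition local_partition S (n : nat) r L : Prop :=
  exists (phi : M -> 'I_n -> R) (c : 'I_n -> M),
    [/\ forall x j, S x -> 0 <= phi x j,
        forall x, S x -> \sum_j phi x j = 1,
        forall x j, S x -> 0 < phi x j -> mdist x (c j) <= r &
        forall x y, S x -> S y -> \sum_j `|phi x j - phi y j| <= L * mdist x y].

(** Write u f - v g = (u - v) g + u (f - g). The hypotheses are conditional because a local
    partition is controlled only where the weight of its cluster is positive. *)
Lemma ldist_scale (n : nat) (f g : 'I_n -> R) (u v D : R) : 0 <= u -> 0 <= v ->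
    (forall j, 0 < u -> 0 <= f j) -> (forall j, 0 < v -> 0 <= g j) ->
    (0 < u -> \sum_j f j = 1) -> (0 < v -> \sum_j g j = 1) -> 0 <= D ->
    (0 < u -> 0 < v -> \sum_j `|f j - g j| <= D) ->
  \sum_j `|u * f j - v * g j| <= `|u - v| + u * D.
Proof.
move=> u0 v0 f0 g0 f1 g1 D0 fgD.
have [uE|u_neq0] := eqVneq u 0.
  rewrite uE mul0r addr0 sub0r normrN ger0_norm//.
  under eq_bigr do rewrite mul0r sub0r normrN normrM (ger0_norm v0).
  rewrite -mulr_sumr; have [->|v_neq0] := eqVneq v 0; first by rewrite mul0r.
  have v_gt0 : 0 < v by rewrite lt_neqAle eq_sym v_neq0.
  under eq_bigr do rewrite ger0_norm ?g0//.
  by rewrite g1// mulr1.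
have u_gt0 : 0 < u by rewrite lt_neqAle eq_sym u_neq0.
have [->|v_neq0] := eqVneq v 0.
  under eq_bigr do rewrite mul0r subr0 ger0_norm ?mulr_ge0 ?f0//.
  by rewrite -mulr_sumr f1// mulr1 subr0 ger0_norm// lerDl mulr_ge0.
have v_gt0 : 0 < v by rewrite lt_neqAle eq_sym v_neq0.
apply: (@le_trans _ _ (\sum_j (`|u - v| * g j + u * `|f j - g j|))); last first.
  by rewrite big_split/= -!mulr_sumr g1// mulr1 lerD2l ler_wpM2l// fgD.
apply: ler_sum => j _.
rewrite (_ : _ - _ = (u - v) * g j + u * (f j - g j)); last ring.
by rewrite (le_trans (ler_normD _ _))// !normrM (ger0_norm u0) (ger0_norm (g0 j v_gt0)).
Qed.

(** Equal labels mean equal centres, hence the same local partition, and [ldist_scale] applies; for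
    different labels refinement leaves the total mass unchanged. Because the weights sum to 1, the
    costs add. *)
Lemma gentle_refine S r r' L L' n : 0 <= L' ->
  gentle S r L ->
  (forall z, local_partition (S `&` [set x | mdist x z <= r]) n r' L') ->
  gentle S r' (L + L').
Proof.
move=> L'0 [I [psi [lab [ctr [psi0 psi1 psir psiL]]]]] loc.
have /choice[phi /choice[c phic]] := loc.
pose z i x := ctr i (lab i x).
have T i x : S x -> 0 < psi i x -> (S `&` [set y | mdist y (z i x) <= r]) x.
  by move=> Sx px; split=> //; apply: psir.
have phi0 i x j : S x -> 0 < psi i x -> 0 <= phi (z i x) x j.
  by move=> Sx px; have [+ _ _ _] := phic (z i x); apply; apply: T.
have phi1 i x : S x -> 0 < psi i x -> \sum_j phi (z i x) x j = 1.
  by move=> Sx px; have [_ + _ _] := phic (z i x); apply; apply: T.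
exists (I * 'I_n)%type, (fun p x => psi p.1 x * phi (z p.1 x) x p.2),
  (fun p => lab p.1), (fun p l => c (ctr p.1 l) p.2).
have psigt i x : S x -> psi i x != 0 -> 0 < psi i x.
  by move=> Sx p0; rewrite lt_neqAle eq_sym p0 psi0.
split=> [[i j] x Sx|x Sx|[i j] x Sx|x y Sx Sy] /=.
- have [->|/psigt px] := eqVneq (psi i x) 0; first by rewrite mul0r.
  by rewrite mulr_ge0 ?psi0// phi0// px.
- rewrite -(pair_bigA _ (fun i j => psi i x * phi (z i x) x j))/= -(psi1 x Sx).
  apply: eq_bigr => i _; rewrite -mulr_sumr.
  have [->|/psigt px] := eqVneq (psi i x) 0; first by rewrite mul0r.
  by rewrite phi1 ?mulr1// px.
- have [->|/psigt px] := eqVneq (psi i x) 0; first by rewrite mul0r ltxx.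
  rewrite pmulr_rgt0 ?px// => h.
  have [_ _ + _] := phic (z i x); apply => //.
  by apply: T => //; apply: px.
- rewrite -(pair_bigA _ (fun i j => ldist (lab i x == lab i y)
    (psi i x * phi (z i x) x j) (psi i y * phi (z i y) y j)))/=.
  apply: (@le_trans _ _ (\sum_i (ldist (lab i x == lab i y) (psi i x) (psi i y)
      + psi i x * (L' * mdist x y)))); last first.
    by rewrite big_split/= -mulr_suml psi1// mul1r mulrDl lerD2r psiL.
  apply: ler_sum => i _.
  have D0 : 0 <= L' * mdist x y by rewrite mulr_ge0 ?mdist_ge0.
  rewrite /ldist; case: eqP => [xy|_].
    have zxy : z i y = z i x by rewrite /z xy.
    apply: ldist_scale; rewrite ?psi0//.
    + by move=> j px; apply: phi0.
    + by move=> j px; apply: phi0.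
    + by move=> px; apply: phi1.
    + by move=> px; apply: phi1.
    + move=> px py; rewrite zxy; have [_ _ _ +] := phic (z i x); apply.
        exact: T.
      by rewrite -zxy; apply: T.
  rewrite big_split/= -!mulr_sumr ler_wpDr//; first by rewrite mulr_ge0 ?psi0.
  have sum1 w : S w -> psi i w * (\sum_j phi (z i w) w j) <= psi i w.
    move=> Sw; have [->|/psigt pw] := eqVneq (psi i w) 0; first by rewrite mul0r.
    by rewrite phi1 ?mulr1// pw.
  by rewrite lerD// sum1.
Qed.

End gentle.

(** * Measurability on the line, and the sample space *)

Section right_open.
Context {R : realType}.

Definition right_open (U : set R) := forall w, U w -> \forall w' \near w^'+, U w'.

Lemma right_openP (U : set R) w : (\forall w' \near w^'+, U w') ->
  exists2 e, 0 < e & forall w', w < w' < w + e -> U w'.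
Proof.
move=> [e /= e0 h]; exists e => // w' /andP[ww' we]; apply: h => //=.
by rewrite ltr0_norm ?subr_lt0// opprB ltrBlDl.
Qed.

(** Each w in U outside the interior has ]w, q] inside U for some rational q. If two such points w <
    v shared q, then v would be interior; so there are only countably many. *)
Lemma right_open_measurable (U : set R) : right_open U ->
  measurable (U : set (measurableTypeR R)).
Proof.
move=> Uro; have -> : U = interior U `|` (U `\` interior U).
  by rewrite setDE setUIr setUv setIT setUidr//; exact: interior_subset.
apply: measurableU; first by apply: open_measurable; exact: open_interior.
apply: countable_measurable; first by move=> t; exact: measurable_set1.
have q w : (U `\` interior U) w -> exists q : rat,
    w < ratr q /\ forall w', w < w' <= ratr q -> U w'.
  move=> [Uw _]; have [e e0 h] := right_openP (Uro w Uw).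
  have /rat_in_itvoo[q] : w < w + e by rewrite ltrDl.
  rewrite in_itv/= => /andP[wq qe]; exists q; split=> // w' /andP[ww' w'q].
  by apply: h; rewrite ww' (le_lt_trans w'q).
pose f w := if pselect ((U `\` interior U) w) is left h
  then sval (cid (q w h)) else 0.
have fP w : (U `\` interior U) w ->
    w < ratr (f w) /\ forall w', w < w' <= ratr (f w) -> U w'.
  by move=> h; rewrite /f; case: pselect => // h'; case: cid.
have key w v : (U `\` interior U) w -> (U `\` interior U) v -> f w = f v -> ~ w < v.
  move=> Uw Uv fwv wv; have [_ hw] := fP w Uw; have [vq _] := fP v Uv.
  apply: Uv.2; apply: (@filterS _ _ _ [set` `]w, (ratr (f w) : R)[]).
    by move=> x /=; rewrite in_itv/= => /andP[wx xq]; apply: hw; rewrite wx ltW.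
  by apply: near_in_itvoo; rewrite in_itv/= wv fwv.
apply/countable_injP; exists (pickle \o f) => w v /set_mem Uw /set_mem Uv.
move=> /(pcan_inj pickleK) fwv; apply/eqP; rewrite eq_le !leNgt.
by apply/andP; split; apply/negP; apply: key.
Qed.

End right_open.

Section mixture.
Context {R : realType}.

Local Notation unit_itv := (`[0, 1[%classic : set R).

Lemma mixture_probability n : exists P : probability (measurableTypeR R) R,
  forall A : set R, P A = ((n.+1%:R^-1)%:E *
    \sum_(k < n.+1) lebesgue_measure ([set t | A (t + k%:R)%R] `&` unit_itv))%E.
Proof.
pose nu : {measure set (measurableTypeR R) -> \bar R} :=
  mrestr (@lebesgue_measure R) (measurable_itv `[0%R, 1%R[).
have mf (k : nat) : measurable_fun [set: measurableTypeR R]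
    (fun t : measurableTypeR R => t + k%:R : measurableTypeR R).
  apply: measurable_funD; [exact: measurable_id|exact: measurable_cst].
pose nuk k : {measure set (measurableTypeR R) -> \bar R} :=
  measure_function_pushforward__canonical__measure_function_Measure nu (mf k).
have c0 : 0 <= n.+1%:R^-1 :> R by rewrite invr_ge0.
pose mu := mscale (NngNum c0) (msum nuk n.+1).
have muE (A : set R) : mu A = ((n.+1%:R^-1)%:E *
    \sum_(k < n.+1) lebesgue_measure ([set t | A (t + k%:R)%R] `&` unit_itv))%E.
  by [].
have mu1 : mu setT = 1%E.
  rewrite muE (eq_bigr (fun=> 1%E)); last first.
    move=> k _; rewrite (_ : [set _ | _] = setT) ?setTI; last by apply/seteqP.
    by rewrite lebesgue_measure_itv/= lte_fin ltr01 oppr0 adde0.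
  by rewrite sumEFin sumr_const card_ord -EFinM mulVf.
pose muP : probability (measurableTypeR R) R :=
  HB.pack mu (@Measure_isProbability.Build _ _ _ mu mu1).
by exists muP.
Qed.

End mixture.

(** * Min-wise sampling, by counting permutations *)

Section minhash.
Variable U : finType.
Implicit Types (p q : U) (A : {set U}) (s : {perm U}).

Definition first A s p : bool :=
  (p \in A) && [forall q in A, enum_rank (s p) <= enum_rank (s q)]%N.

Lemma first_inj A s p q : first A s p -> first A s q -> p = q.
Proof.
move=> /andP[pA /forall_inP pmin] /andP[qA /forall_inP qmin].
apply: (@perm_inj _ s); apply: enum_rank_inj; apply/val_inj/eqP.
by rewrite eqn_leq pmin ?qmin.
Qed.

Lemma first_exists A s p : p \in A -> exists q, first A s q.
Proof.
move=> pA; case: (arg_minnP (fun q => enum_rank (s q) : nat) pA) => q qA qmin.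
by exists q; apply/andP; split=> //; apply/forall_inP => r /qmin.
Qed.

Lemma first_sub A B s p : first B s p -> p \in A -> A \subset B -> first A s p.
Proof.
move=> /andP[_ /forall_inP pmin] pA /fintype.subsetP AB; rewrite /first pA.
by apply/forall_inP => q /AB; apply: pmin.
Qed.

(** Composition with the transposition of p and q injects the orders with p first into those with q
    first. *)
Lemma card_first_le A p q : p \in A -> q \in A ->
  (#|[set s | first A s p]%SET| <= #|[set s | first A s q]%SET|)%N.
Proof.
move=> pA qA; rewrite -(card_imset _ (@mulgI _ (tperm p q))).
apply/subset_leq_card/fintype.subsetP => _ /imsetP[s + ->]; rewrite !inE.
move=> /andP[_ /forall_inP pmin]; rewrite /first. rewrite qA; apply/forall_inP => r rA.
rewrite !permM tpermR; apply: pmin.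
by case: tpermP => // ->.
Qed.

Lemma sum_first A s : (\sum_(p in A) first A s p <= 1)%N.
Proof.
case: (pickP (fun p => (p \in A) && first A s p)) => [p /andP[pA pf]|none].
  rewrite (bigD1 p)//= big1 ?addn0; first exact: leq_b1.
  move=> q /andP[_ qp]; apply/eqP; rewrite eqb0; apply: contraNN qp => qf.
  by apply/eqP; apply: first_inj qf pf.
by rewrite big1// => q qA; have := none q; rewrite qA/= => ->.
Qed.

Lemma cardset_sum (T : finType) (P : pred T) : #|[set t | P t]%SET| = (\sum_t P t)%N.
Proof. by rewrite -sum1dep_card big_mkcond; apply: eq_bigr => t _; case: (P t). Qed.

Lemma card_first A p : p \in A -> (#|A| * #|[set s | first A s p]%SET| <= #|{perm U}|)%N.
Proof.
move=> pA.
apply: (@leq_trans (\sum_(q in A) #|[set s | first A s q]%SET|)).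
  by rewrite -sum_nat_const; apply: leq_sum => q qA; apply: card_first_le.
under eq_bigr do rewrite cardset_sum.
rewrite exchange_big/= -sum1_card; apply: leq_sum => s _; exact: sum_first.
Qed.

(** Under a uniform order each element of A comes first with probability at most [1 / #|A|]; this is
    the union bound over D, without divisions. *)
Lemma card_minhash A (D : {set U}) :
  (#|[set s | [exists p in D, first A s p]]%SET| * #|A| <= #|D| * #|{perm U}|)%N.
Proof.
apply: (@leq_trans (\sum_(p in D) #|[set s | first A s p]%SET| * #|A|)).
  rewrite -big_distrl/= leq_mul2r; apply/orP; right.
  under eq_bigr do rewrite cardset_sum.
  rewrite cardset_sum exchange_big/=; apply: leq_sum => s _.
  case: exists_inP => // -[p pD pf].
  by rewrite (bigD1 p)//= pf.
rewrite -sum_nat_const; apply: leq_sum => p pD.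
have [pA|pA] := boolP (p \in A); first by rewrite mulnC card_first.
rewrite (_ : [set s | _]%SET = finset.set0) ?cards0//.
by apply/setP => s; rewrite !inE /first (negbTE pA).
Qed.

End minhash.

(** * Integration over the threshold *)

Section unit_interval.
Context {R : realType}.
Local Notation mu := (@lebesgue_measure R).
Local Notation unit_itv := (`[0, 1[%classic : set R).

(** The interval [u, v[ is cut at the integers; the length of each slice is a difference of clamps
    min(x, a), and these telescope. *)
Lemma sum_unit_itv (J : nat) (u v : R) : 0 <= u <= v -> v <= J%:R ->
  (\sum_(a < J) mu ([set t | u <= a%:R + t < v]%R `&` unit_itv) <= (v - u)%:E)%E.
Proof.
move=> /andP[u0 uv] vJ.
pose g (x : R) (a : nat) := Num.min x a%:R.
have gE x : 0 <= x <= J%:R -> \sum_(a < J) (g x a.+1 - g x a) = x.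
  move=> /andP[x0 xJ]; rewrite -(big_mkord xpredT (fun a => g x a.+1 - g x a)).
  by rewrite telescope_sumr// /g (min_idPl _)// (min_idPr _)// subr0.
have -> : v - u = \sum_(a < J) ((g v a.+1 - g v a) - (g u a.+1 - g u a)).
  by rewrite sumrB !gE ?u0 ?(le_trans u0)// (le_trans uv).
rewrite -sumEFin; apply: lee_sum => a _.
have -> : [set t | u <= a%:R + t < v] `&` unit_itv =
    `[Num.max 0 (u - a%:R), Num.min 1 (v - a%:R)[%classic.
  apply/seteqP; split => t /=; rewrite !in_itv/= ge_max lt_min.
    by move=> [/andP[ut tv] /andP[t0 t1]]; rewrite t0 t1/=; lra.
  by move=> /andP[/andP[t0 ut] /andP[t1 tv]]; rewrite t0 t1; split=> //; lra.
rewrite lebesgue_measure_itv/= lte_fin; move: (a : nat) => {}a.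
rewrite /g -natr1 !minEle !maxEle.
case: ifPn => [|_]; rewrite ?lte_fin -?EFinB lee_fin; do ! case: ifPn; rewrite -?ltNge => *; lra.
Qed.

Lemma sum_lebesgue_le (K : nat) (B : nat -> set R) (U : finType) (D : U -> set R) (c : R) :
    0 <= c -> (forall k, measurable (B k : set (measurableTypeR R))) ->
    (forall p, measurable (D p : set (measurableTypeR R))) ->
    (forall t, 0 <= t < 1 -> \sum_(k < K) \1_(B k) t <= c * \sum_p \1_(D p) t) ->
  (\sum_(k < K) mu (B k `&` unit_itv) <= c%:E * \sum_p mu (D p `&` unit_itv))%E.
Proof.
move=> c0 mB mD BD.
have mI : measurable (unit_itv : set (measurableTypeR R)) by exact: measurable_itv.
under eq_bigr do rewrite -(integral_indic _ mI (mB _)).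
under [in leRHS]eq_bigr do rewrite -(integral_indic _ mI (mD _)).
have mind (X : set R) : measurable (X : set (measurableTypeR R)) ->
    measurable_fun unit_itv (fun t : measurableTypeR R => (\1_X t)%:E).
  move=> mX; apply/measurable_EFinP; apply: measurable_funTS.
  exact: measurable_indic.
rewrite -!ge0_integral_sum//; try by move=> k; apply: mind.
rewrite -ge0_integralZl//; last 2 first.
- by apply: emeasurable_sum => p; apply: mind.
- by move=> t _; apply: sume_ge0.
apply: ge0_le_integral => //.
- by move=> t _; apply: sume_ge0.
- by apply: emeasurable_sum => k; apply: mind.
- apply: measurable_funeM; by apply: emeasurable_sum => p; apply: mind.
- move=> t /=; rewrite in_itv/= => t01.
  by rewrite !sumEFin -EFinM lee_fin BD.
Qed.

End unit_interval.

(** * Random partitions sampled from partitions of unity *)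

Section cluster_of.
Context {R : realType} {N : metricType R} (Pi : random_partition N).

Lemma cluster_ofE k w x : rp_cluster Pi k w x -> cluster_of Pi w x = rp_cluster Pi k w.
Proof.
move=> kx; rewrite /cluster_of /pblock /pblock_index.
have : exists l, [set: nat] l /\ rp_cluster Pi l w x by exists k.
move=> /getPex [_ h]; congr (rp_cluster Pi _ w).
by apply: (@rp_trivIset _ _ Pi w) => //; exists x.
Qed.

Lemma cluster_of_eq k w x y : rp_cluster Pi k w x -> rp_cluster Pi k w y ->
  cluster_of Pi w x = cluster_of Pi w y.
Proof. by move=> /cluster_ofE -> /cluster_ofE ->. Qed.

End cluster_of.

Section conversion.
Context {R : realType} {N : metricType R}.
Variables (I : finType) (psi : I -> N -> R) (lab : I -> N -> nat).
Hypothesis psi_ge0 : forall i x, 0 <= psi i x.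
Hypothesis psi_sum : forall x, \sum_i psi i x = 1.

Let J := (2 * #|I|)%N.
Let U : finType := (I * 'I_J)%type.

(* The integral part of [w] selects a permutation and its fractional part the
   threshold that activates the pairs [(i, a)]; [x] goes to the cluster named by its
   first active pair and the label there.  Weights are cut into pieces of size [1 / J];
   since [J = 2 * #|I|], rounding leaves at least [#|I|] active pairs at every
   threshold. *)
Definition frac (w : R) := w - (Num.floor w)%:~R.

Definition active (t : R) (x : N) : {set U} :=
  [set p : U | p.2%:R + t < J%:R * psi p.1 x]%SET.

(** A partition must exist at every real w; the absolute value and the default permutation take care
    of w outside the range of the mixture, a null set. *)
Definition order_of (w : R) : {perm U} := nth 1%g (enum {perm U}) `|Num.floor w|%N.

(** The number k encodes a pair with a label; numbers that are no code give empty clusters. *)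
Definition cluster (k : nat) (w : R) : set N :=
  [set x | if (pickle_inv k : option (U * nat)) is Some pl then
     first (active (frac w) x) (order_of w) pl.1 && (lab pl.1.1 x == pl.2)
   else false].

Lemma near_floor (w : R) : \forall w' \near w^'+, Num.floor (w' : R) = Num.floor w.
Proof.
have h : w < (Num.floor w + 1)%:~R by rewrite floorD1_gt.
near=> w'; apply: floor_def; apply/andP; split.
  by apply: (@le_trans _ _ w); [exact: floor_le|near: w'; exact: nbhs_right_ge].
by near: w'; exact: nbhs_right_lt.
Unshelve. all: by end_near. Qed.

(** Active pairs stay active because the inequality is strict, inactive ones stay inactive because
    the threshold increases: hence openness from the right. The shift c will be the integral part of
    w. *)
Lemma near_active c x w :
  \forall w' \near w^'+, active (w' - c) x = active (w - c) x.
Proof.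
suff : \forall w' \near w^'+, forall p : U,
    (p \in active (w' - c) x) = (p \in active (w - c) x).
  by apply: filterS => w' h; apply/setP.
apply: filter_forall => p; rewrite !inE.
have [h|h] := ltP (p.2%:R + (w - c)) (J%:R * psi p.1 x).
  near=> w'; rewrite inE.
  have : w' < w + (J%:R * psi p.1 x - (p.2%:R + (w - c))).
    by near: w'; apply: nbhs_right_lt; rewrite ltrDl subr_gt0.
  by lra.
near=> w'; rewrite inE; apply/negbTE; rewrite -leNgt (le_trans h)//.
by rewrite lerD2l lerD2r; near: w'; exact: nbhs_right_ge.
Unshelve. all: by end_near. Qed.

Lemma near_active0 x w : \forall w' \near w^'+, active w' x = active w x.
Proof. by apply: filterS (near_active 0 x w) => w'; rewrite !subr0. Qed.

Lemma near_cluster k x w : \forall w' \near w^'+, cluster k w' x <-> cluster k w x.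
Proof.
near=> w'.
have fl : Num.floor w' = Num.floor w by near: w'; exact: near_floor.
have ac : active (w' - (Num.floor w)%:~R) x = active (frac w) x.
  by near: w'; exact: near_active.
by rewrite /cluster /order_of /frac fl /= ac.
Unshelve. all: by end_near. Qed.

Lemma frac_itv w : 0 <= frac w < 1.
Proof.
by rewrite /frac subr_ge0 floor_le ltrBlDl -[X in _ < _ + X]/(1%:~R) -intrD floorD1_gt.
Qed.

Lemma card_active t x : t < 1 -> (#|I| <= #|active t x|)%N.
Proof.
move=> t1.
pose g (v : R) (a : nat) := Num.min v a%:R.
have psi_le1 i : psi i x <= 1.
  by rewrite -(psi_sum x) (bigD1 i)//= lerDl sumr_ge0.
rewrite -(ler_nat R).
apply: (@le_trans _ _ (\sum_i \sum_(a < J) (a%:R + t < J%:R * psi i x)%R%:R)); last first.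
  rewrite pair_bigA /= /active cardset_sum natr_sum.
  by apply: ler_sum => p _.
apply: (@le_trans _ _ (\sum_i (J%:R * psi i x - 1))).
  rewrite sumrB -mulr_sumr psi_sum mulr1 sumr_const /J natrM.
  by lra.
apply: ler_sum => i _; set v := J%:R * psi i x.
apply: (@le_trans _ _ (\sum_(a < J) (g v a.+2 - g v a.+1))).
  rewrite -(big_mkord xpredT (fun a => g v a.+2 - g v a.+1)).
  rewrite (telescope_sumr (fun a => g v a.+1))// /g.
  have vJ : v <= J.+1%:R.
    by rewrite (@le_trans _ _ J%:R) ?ler_nat// /v ler_piMr.
  by rewrite (min_idPl vJ) lerD2l lerN2 ge_min lexx orbT.
apply: ler_sum => a _; rewrite /g -(natr1 a.+1) -(natr1 a) !minEle.
move: (a : nat) => {}a.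
by case: ltP => h; do ! case: ifPn; rewrite -?ltNge => * /=; lra.
Qed.

Lemma cluster_exists w x : exists k, cluster k w x.
Proof.
have /card_gt0P[p pa] : (0 < #|active (frac w) x|)%N.
  apply: leq_trans (card_active x _); last by have /andP[] := frac_itv w.
  rewrite lt0n; apply/negP => /eqP /card0_eq I0.
  by have := psi_sum x; rewrite big_pred0// => /eqP; rewrite eq_sym oner_eq0.
have [q qf] := first_exists (order_of w) pa.
exists (pickle (q, lab q.1 x)); rewrite /cluster /= pickleK_inv /= qf eqxx//.
Qed.

Lemma cluster_inj w x k l : cluster k w x -> cluster l w x -> k = l.
Proof.
rewrite /cluster /=.
have := @pickle_invK (U * nat)%type k; have := @pickle_invK (U * nat)%type l.
case: (pickle_inv k) => [[p a]|]//=; case: (pickle_inv l) => [[q b]|]//=.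
move=> <- <- /andP[pf /eqP <-] /andP[qf /eqP <-].
by rewrite (first_inj pf qf).
Qed.

Let mixture := cid (@mixture_probability R #|{perm U}|.-1).

(** A witness in E stays in the cluster slightly to the right of w, so the event is open from the
    right. *)
Lemma cluster_measurable k (E : set N) : closed E ->
  measurable ([set w | E `&` cluster k w !=set0] : set (measurableTypeR R)).
Proof.
move=> _; apply: right_open_measurable => w [x [Ex kx]].
near=> w'; exists x; split=> //.
by apply/(_ : cluster k w' x <-> cluster k w x); first by near: w'; exact: near_cluster.
Unshelve. all: by end_near. Qed.

Lemma cluster_cover w : cover setT (cluster ^~ w) = setT.
Proof.
apply/seteqP; split=> // x _; have [k kx] := cluster_exists w x.
by exists k.
Qed.

Lemma cluster_trivIset w : trivIset setT (cluster ^~ w).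
Proof. by move=> k l _ _ [x [kx lx]]; apply: cluster_inj kx lx. Qed.

Definition sampled_partition : random_partition N :=
  @RandomPartition R N _ (measurableTypeR R) (sval mixture) cluster
    cluster_measurable cluster_cover cluster_trivIset.

Lemma sampled_partition_bounded Delta :
    (forall i x y, 0 < psi i x -> 0 < psi i y -> lab i x = lab i y ->
      mdist x y <= Delta) ->
  bounded_rp Delta sampled_partition.
Proof.
move=> bd w x; have [k kx] := cluster_exists w x.
rewrite (@cluster_ofE _ _ sampled_partition _ _ _ kx); apply: ub_ereal_sup => _ [y ky [z kz <-]].
rewrite lee_fin; move: (ky : cluster k w y) (kz : cluster k w z).
rewrite /cluster /=.
case: (pickle_inv k) => [[[i a] l]|]//=.
move=> /andP[/andP[+ _] /eqP yl] /andP[/andP[+ _] /eqP zl].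
rewrite !inE /= => py pz; apply: (bd i); last by rewrite yl zl.
- have t0 : 0 <= a%:R + frac w by rewrite addr_ge0//; case/andP: (frac_itv w).
  have := le_lt_trans t0 py; rewrite lt_neqAle => /andP[+ _].
  by rewrite lt_neqAle psi_ge0 andbT; apply: contraNneq => <-; rewrite mulr0.
- have t0 : 0 <= a%:R + frac w by rewrite addr_ge0//; case/andP: (frac_itv w).
  have := le_lt_trans t0 pz; rewrite lt_neqAle => /andP[+ _].
  by rewrite lt_neqAle psi_ge0 andbT; apply: contraNneq => <-; rewrite mulr0.
Qed.

Definition disputed (t : R) (x y : N) : {set U} :=
  [set p : U | ((p \in active t x) != (p \in active t y)) ||
    [&& p \in active t x, p \in active t y & lab p.1 x != lab p.1 y]]%SET.

Definition split_event (x y : N) (k : nat) : set R :=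
  [set t | [exists p in disputed t x y,
     first (active t x :|: active t y)%SET (nth 1%g (enum {perm U}) k) p]].

(** If the first pair active for x or y is undisputed, it is active for both, hence first for each
    of them, with equal labels. *)
Lemma not_split x y w : ~ split_event x y `|Num.floor w|%N (frac w) ->
  exists k, cluster k w x /\ cluster k w y.
Proof.
rewrite /split_event /= => /negP; rewrite negb_exists_in => /forall_inP nsplit.
have [k kx] := cluster_exists w x.
have [p0 p0x] : exists p, p \in active (frac w) x.
  move: kx; rewrite /cluster/=; case: (pickle_inv k) => [[p l]|]//=.
  by move=> /andP[/andP[+ _] _] => h; exists p.
have p0xy : p0 \in (active (frac w) x :|: active (frac w) y)%SET.
  by rewrite finset.in_setU p0x.
have [p pf] := first_exists (order_of w) p0xy.
have : p \notin disputed (frac w) x y.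
  by apply/negP => /nsplit; rewrite -/(order_of w) pf.
have pxy : (p \in active (frac w) x) || (p \in active (frac w) y).
  by move: pf => /andP[+ _]; rewrite finset.in_setU.
rewrite !inE negb_or negbK => /andP[/eqP pE].
move: pxy; rewrite !inE pE orbb => py.
rewrite py /= negbK => /eqP lE.
have px' : p \in active (frac w) x by rewrite inE pE.
have py' : p \in active (frac w) y by rewrite inE.
have cx : cluster (pickle (p, lab p.1 x)) w x.
  rewrite /cluster/= pickleK_inv/= eqxx andbT.
  by apply: first_sub pf px' _; apply: finset.subsetUl.
have cy : cluster (pickle (p, lab p.1 x)) w y.
  rewrite /cluster/= pickleK_inv/= lE eqxx andbT.
  by apply: first_sub pf py' _; apply: finset.subsetUr.
by exists (pickle (p, lab p.1 x)); split; [exact: cx|exact: cy].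
Qed.

Lemma near_disputed x y t : \forall t' \near t^'+, disputed t' x y = disputed t x y.
Proof.
near=> t'; rewrite /disputed.
have -> : active t' x = active t x by near: t'; exact: near_active0.
by have -> : active t' y = active t y by near: t'; exact: near_active0.
Unshelve. all: by end_near. Qed.

Lemma split_event_measurable x y k :
  measurable (split_event x y k : set (measurableTypeR R)).
Proof.
apply: right_open_measurable => t; rewrite /split_event /= => h.
near=> t'; rewrite /=.
have -> : disputed t' x y = disputed t x y by near: t'; exact: near_disputed.
have -> : active t' x = active t x by near: t'; exact: near_active0.
by have -> : active t' y = active t y by near: t'; exact: near_active0.
Unshelve. all: by end_near. Qed.

Lemma disputed_measurable x y p :
  measurable ([set t | p \in disputed t x y] : set (measurableTypeR R)).
Proof.
apply: right_open_measurable => t /= h; near=> t'; rewrite /=.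
by have -> : disputed t' x y = disputed t x y by near: t'; exact: near_disputed.
Unshelve. all: by end_near. Qed.

Definition cut x y : set R := [set w | ~ exists k, cluster k w x /\ cluster k w y].

Lemma cut_measurable x y : measurable (cut x y : set (measurableTypeR R)).
Proof.
apply: right_open_measurable => w h.
have [k kx] := cluster_exists w x; have [l ly] := cluster_exists w y.
near=> w'.
have kx' : cluster k w' x.
  by apply/(_ : cluster k w' x <-> cluster k w x) => //; near: w'; exact: near_cluster.
have ly' : cluster l w' y.
  by apply/(_ : cluster l w' y <-> cluster l w y) => //; near: w'; exact: near_cluster.
move=> [m [mx my]]; apply: h; exists k; split; first exact: kx.
by rewrite (cluster_inj kx' mx) (cluster_inj my ly').
Unshelve. all: by end_near. Qed.

Local Notation mu := (@lebesgue_measure R).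
Local Notation unit_itv := (`[0, 1[%classic : set R).

(** For fixed i, a dispute about (i, a) puts a + t between [J * psi i x] and [J * psi i y], or, when
    the labels differ, below the larger of them; these lengths are at most J times [ldist]. *)
Lemma disputed_measure x y :
  (\sum_p mu ([set t | p \in disputed t x y] `&` unit_itv) <=
   (J%:R * \sum_i ldist (lab i x == lab i y) (psi i x) (psi i y))%:E)%E.
Proof.
rewrite (eq_bigr (fun p : I * 'I_J =>
  mu ([set t | (p.1, p.2) \in disputed t x y] `&` unit_itv))); last by case.
rewrite -(pair_bigA _ (fun (i : I) (a : 'I_J) =>
  mu ([set t | (i, a) \in disputed t x y] `&` unit_itv)))/=.
rewrite mulr_sumr -sumEFin; apply: lee_sum => i _.
pose v := J%:R * Num.max (psi i x) (psi i y).
pose u := if lab i x == lab i y then J%:R * Num.min (psi i x) (psi i y) else 0.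
have psi_le1 z : psi i z <= 1.
  by rewrite -(psi_sum z) (bigD1 i)//= lerDl sumr_ge0.
have uv : 0 <= u <= v.
  rewrite /u /v; case: ifP => _; last by rewrite lexx mulr_ge0// le_max psi_ge0.
  rewrite mulr_ge0 ?le_min ?psi_ge0//= ler_wpM2l// ge_min le_max lexx//.
have vJ : v <= J%:R by rewrite /v ler_piMr// ge_max !psi_le1.
apply: (@le_trans _ _ (v - u)%:E); last first.
  rewrite lee_fin /u /v /ldist; case: ifP => _.
    rewrite -mulrBr ler_wpM2l//.
    have [xy|xy] := leP (psi i x) (psi i y).
      by rewrite distrC ger0_norm// subr_ge0.
    by rewrite ger0_norm// subr_ge0 ltW.
  rewrite subr0 ler_wpM2l// ge_max lerDl lerDr !psi_ge0//.
apply: le_trans (sum_unit_itv uv vJ); apply: lee_sum => a _.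
apply: le_measure; rewrite ?inE.
- by apply: measurableI; [exact: disputed_measurable|exact: measurable_itv].
- apply: measurableI; last exact: measurable_itv.
  rewrite (_ : [set t | _] = `[u - a%:R, v - a%:R[%classic); first exact: measurable_itv.
  apply/seteqP; split => t /=; rewrite in_itv/=; lra.
- move=> t /= [pd t01]; split=> //.
  have {}t01 : 0 <= a%:R + t.
    by move: t01; rewrite in_itv/= => /andP[t0 _]; rewrite addr_ge0.
  move: pd; rewrite !inE /= /u /v maxr_pMr// minr_pMr//.
  rewrite lt_max; case: (lab i x =P lab i y) => _ /=; rewrite ?ge_min ?t01.
    by case: (ltP _ (J%:R * psi i x)); case: (ltP _ (J%:R * psi i y)); rewrite //= ?orbT.
  by case: (ltP _ (J%:R * psi i x)); case: (ltP _ (J%:R * psi i y)); rewrite //= ?orbT.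
Qed.

Lemma split_event_count x y t : 0 <= t < 1 ->
  \sum_(k < #|{perm U}|) \1_(split_event x y k) t <=
  (#|{perm U}|%:R / #|I|%:R) * \sum_p \1_[set s | p \in disputed s x y] t :> R.
Proof.
move=> /andP[t0 t1].
have I0 : (0 < #|I|)%N.
  rewrite lt0n; apply/negP => /eqP /card0_eq I0.
  by have := psi_sum x; rewrite big_pred0// => /eqP; rewrite eq_sym oner_eq0.
set A := (active t x :|: active t y)%SET; set D := disputed t x y.
have IA : (#|I| <= #|A|)%N.
  by rewrite (leq_trans (card_active x t1))// subset_leq_card// finset.subsetUl.
have -> : \sum_(k < #|{perm U}|) \1_(split_event x y k) t =
    #|[set s : {perm U} | [exists p in D, first A s p]]%SET|%:R :> R.
  rewrite cardset_sum natr_sum -[RHS]big_enum /= [RHS](big_nth 1%g) -cardE [RHS]big_mkord.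
  apply: eq_bigr => k _; rewrite indicE; congr (_%:R).
  by rewrite mem_setE.
have -> : \sum_p \1_[set s | p \in disputed s x y] t = #|D|%:R :> R.
  rewrite -sum1_card natr_sum [RHS]big_mkcond/=; apply: eq_bigr => p _.
  rewrite indicE; have -> : (t \in [set s | p \in disputed s x y]) = (p \in D).
    by apply/idP/idP => [/set_mem|/mem_set].
  by case: (p \in D).
rewrite mulrAC ler_pdivlMr ?ltr0n// -!natrM ler_nat.
rewrite mulnC [leqRHS]mulnC (leq_trans _ (card_minhash A D))//.
by rewrite mulnC leq_mul2l IA orbT.
Qed.

(** The factor 2 is [J / #|I|]: the scale of the disputed pieces over the least number of active
    ones. *)
Lemma cut_prob x y : (sval mixture (cut x y) <=
  (2 * \sum_i ldist (lab i x == lab i y) (psi i x) (psi i y))%:E)%E.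
Proof.
have M0 : (0 < #|{perm U}|)%N by apply/card_gt0P; exists 1%g.
have I0 : (0 < #|I|)%N.
  rewrite lt0n; apply/negP => /eqP /card0_eq I0.
  by have := psi_sum x; rewrite big_pred0// => /eqP; rewrite eq_sym oner_eq0.
rewrite (svalP mixture) prednK//.
have mI : measurable (unit_itv : set (measurableTypeR R)) by exact: measurable_itv.
apply: (@le_trans _ _ ((#|{perm U}|%:R^-1)%:E *
   \sum_(k < #|{perm U}|) mu (split_event x y k `&` unit_itv))%E).
  apply: lee_wpmul2l; first by rewrite lee_fin invr_ge0.
  apply: lee_sum => k _; apply: le_measure; rewrite ?inE.
  - apply: measurableI => //.
    have mf : measurable_fun [set: measurableTypeR R]
        (fun t : measurableTypeR R => t + k%:R : measurableTypeR R).
      by apply: measurable_funD; [exact: measurable_id|exact: measurable_cst].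
    by have := mf measurableT _ (cut_measurable x y); rewrite setTI.
  - by apply: measurableI => //; apply: split_event_measurable.
  - move=> t /= [h t01]; split=> //; apply: contrapT => ns; apply: h.
    have := @not_split x y (t + k%:R); rewrite /frac.
    have -> : Num.floor (t + k%:R) = k.
      apply: floor_def; move: t01; rewrite in_itv/= => /andP[t0 t1].
      by rewrite intrD; apply/andP; split; [rewrite lerDr|rewrite addrC ltrD2l].
    by rewrite addrK; apply.
have := @sum_lebesgue_le R #|{perm U}| (split_event x y) _
  (fun p => [set t | p \in disputed t x y]) (#|{perm U}|%:R / #|I|%:R) _
  (split_event_measurable x y) (disputed_measurable x y) (@split_event_count x y).
have c0 : 0 <= #|{perm U}|%:R / #|I|%:R :> R by rewrite divr_ge0.
move=> /(_ c0) /le_trans h.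
apply: (@le_trans _ _ ((#|{perm U}|%:R^-1)%:E * ((#|{perm U}|%:R / #|I|%:R)%:E *
   (J%:R * \sum_i ldist (lab i x == lab i y) (psi i x) (psi i y))%:E))%E).
  apply: lee_wpmul2l; first by rewrite lee_fin invr_ge0.
  apply: h; apply: lee_wpmul2l; first by rewrite lee_fin.
  exact: disputed_measure.
rewrite -!EFinM lee_fin /J natrM le_eqVlt; apply/orP; left; apply/eqP.
by field; rewrite !pnatr_eq0 -!lt0n I0 M0.
Qed.

Lemma sampled_partition_separating x y :
  (rp_prob sampled_partition [set w | cluster_of sampled_partition w x <>
      cluster_of sampled_partition w y]
   <= (2 * \sum_i ldist (lab i x == lab i y) (psi i x) (psi i y))%:E)%E.
Proof.
rewrite (_ : [set w | _] = cut x y); first exact: cut_prob.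
apply/seteqP; split => w /= h.
  move=> [k [kx ky]]; apply: h.
  exact: (@cluster_of_eq _ _ sampled_partition _ _ _ _ kx ky).
move=> e; apply: h; have [k kx] := cluster_exists w x; exists k; split; first exact: kx.
have [l ly] := cluster_exists w y.
have ex := @cluster_ofE _ _ sampled_partition _ _ _ kx.
have ey := @cluster_ofE _ _ sampled_partition _ _ _ ly.
have kl : cluster k w = cluster l w := etrans (esym ex) (etrans e ey).
by rewrite kl.
Qed.

End conversion.

Lemma SEP_gentle (R : realType) (M : metricType R) (S : set M) (Delta L : R) :
  0 < Delta -> 0 <= L -> gentle S (Delta / 2) L ->
  (SEP (set_type S) Delta <= (2 * L * Delta)%:E)%E.
Proof.
move=> D0 L0 [I [psi [lab [ctr [psi0 psi1 psir psiL]]]]].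
apply: ereal_inf_lbound; exists (2 * L * Delta) => //=; split.
  by rewrite !mulr_ge0// ltW.
have Sv (x : S) : S (set_val x) by exact: set_valP.
exists (@sampled_partition R S I (fun i x => psi i (set_val x))
  (fun i x => lab i (set_val x)) (fun i x => psi0 i _ (Sv x)) (fun x => psi1 _ (Sv x))).
split.
  apply: sampled_partition_bounded => i x y px py xy.
  have := psir i _ (Sv x) px; have := psir i _ (Sv y) py; rewrite -xy.
  set c := ctr _ _ => yc xc.
  have := metric_triangle (set_val x) c (set_val y); rewrite (metric_sym c) => h.
  by apply: (le_trans h); rewrite (splitr Delta) lerD.
move=> x y; apply: le_trans; first exact: sampled_partition_separating.
rewrite lee_fin mulfK ?gt_eqF// -mulrA ler_pM2l//.
exact: psiL (Sv x) (Sv y).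
Qed.

(** * Pointwise inequalities for the signed power *)

Section signed_power.
Context {R : realType}.
Implicit Types a b p q t : R.

(** Young's inequality for t and 1 with exponents q and q/(q - 1). *)
Lemma powR_bernoulli t q : 0 <= t -> 1 <= q -> 1 + q * (t - 1) <= t `^ q.
Proof.
move=> t0; rewrite le_eqVlt => /predU1P[<-|q1]; first by rewrite powRr1//; lra.
have q0 : 0 < q by lra.
have q1' : 0 < q - 1 by lra.
have := @conjugate_powR R t 1 q (q / (q - 1)) t0 ler01 q0 (divr_gt0 q0 q1').
rewrite powR1 mulr1 => h.
have : t <= t `^ q / q + 1 / (q / (q - 1)).
  by apply: h; field; rewrite !gt_eqF.
rewrite (_ : 1 / (q / (q - 1)) = (q - 1) / q); last by field; rewrite !gt_eqF.
by rewrite -mulrDl ler_pdivlMr//; lra.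
Qed.

Lemma powR_diff a b q : 0 <= b <= a -> 1 <= q ->
  a `^ q - b `^ q <= q * (a - b) * a `^ (q - 1).
Proof.
move=> /andP[b0 ba] q1; have a0 : 0 <= a := le_trans b0 ba.
have [aE|a_neq0] := eqVneq a 0.
  have -> : b = 0 by apply/eqP; rewrite eq_le b0 -aE ba.
  by rewrite aE !subrr mulr0 mul0r.
have {a_neq0} a_gt0 : 0 < a by rewrite lt_neqAle eq_sym a_neq0.
have h := powR_bernoulli (divr_ge0 b0 a0) q1.
have -> : b `^ q = a `^ q * (b / a) `^ q.
  by rewrite -powRM ?divr_ge0// mulrC divfK// gt_eqF.
have -> : a `^ q = a * a `^ (q - 1) by rewrite mulr_powRB1//; lra.
rewrite -{1}[a * _]mulr1 -mulrBr.
have -> : q * (a - b) * a `^ (q - 1) = a * a `^ (q - 1) * (q * (1 - b / a)).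
  by field; rewrite gt_eqF.
by rewrite ler_wpM2l ?mulr_ge0 ?powR_ge0//; lra.
Qed.

(** For q = p/2, applied pointwise, this is the Mazur map from L_p to L_2. *)
Definition spow q a : R := Num.sg a * `|a| `^ q.

Lemma spow_norm q a : 0 < q -> `|spow q a| = `|a| `^ q.
Proof.
move=> q0; rewrite /spow normrM normr_sg (ger0_norm (powR_ge0 _ _)).
by case: eqVneq => [->|]; rewrite ?mul1r// mul0r normr0 powR0// gt_eqF.
Qed.

Lemma spow_pos q a : 0 < q -> 0 <= a -> spow q a = a `^ q.
Proof.
move=> q0 a0; have := spow_norm a q0; rewrite ger0_norm ?(ger0_norm a0)//.
by rewrite /spow mulr_ge0 ?powR_ge0// sgr_ge0.
Qed.

Lemma spowN q a : spow q (- a) = - spow q a.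
Proof. by rewrite /spow sgrN normrN mulNr. Qed.

(** This form without the sign function makes measurability immediate. *)
Lemma spowE q a : 0 < q -> spow q a = Num.max a 0 `^ q - Num.max (- a) 0 `^ q.
Proof.
move=> q0; have q_neq0 : q != 0 by rewrite gt_eqF.
case: (boolP (0 <= a)) => [a0|]; last rewrite -ltNge => a0.
  rewrite spow_pos// (max_idPl a0) (max_idPr _) ?oppr_le0//.
  by rewrite powR0// subr0.
rewrite -[a in LHS]opprK spowN spow_pos ?oppr_ge0 ?(ltW a0)//.
rewrite [Num.max a 0](max_idPr (ltW a0)) (max_idPl _) ?oppr_ge0 ?(ltW a0)//.
by rewrite powR0// sub0r.
Qed.

Lemma sign_swap_wlog (P : R -> R -> Prop) :
  (forall a b, P a b -> P b a) -> (forall a b, P a b -> P (- a) (- b)) ->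
  (forall a b, `|b| <= a -> P a b) -> forall a b, P a b.
Proof.
move=> Psym PN Pba a b.
wlog ab : a b / `|b| <= `|a|.
  move=> h; have [ba|/ltW ab] := leP `|b| `|a|; first exact: h.
  by apply: Psym; apply: h.
have [a0|a0] := leP 0 a; first by apply: Pba; rewrite (ger0_norm a0) in ab.
rewrite -[a]opprK -[b]opprK; apply/PN/Pba.
by rewrite normrN; rewrite (ltr0_norm a0) in ab.
Qed.

Lemma spow_lip q a b : 1 <= q ->
  `|spow q a - spow q b| <= q * `|a - b| * Num.max `|a| `|b| `^ (q - 1).
Proof.
move=> q1; have q0 : 0 < q by lra.
move: a b; apply: sign_swap_wlog => [a b|a b|a b ba].
- by rewrite distrC (distrC a) maxC.
- by rewrite !spowN -!opprD !normrN.
have a0 : 0 <= a := le_trans (normr_ge0 _) ba.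
rewrite (ger0_norm a0) (max_idPl ba) (spow_pos q0 a0).
have [b0|b0] := leP 0 b.
  rewrite spow_pos//; rewrite ger0_norm// in ba.
  rewrite !ger0_norm ?subr_ge0 ?ge0_ler_powR ?nnegrE//; last lra.
  by apply: powR_diff; rewrite ?b0.
rewrite -[b]opprK spowN opprK; move: ba; rewrite ltr0_norm//.
have {b0} : 0 <= - b by lra.
move: (- b) => {}b b0 ba; rewrite opprK spow_pos//.
rewrite !ger0_norm ?addr_ge0 ?powR_ge0//.
have -> : a `^ q = a * a `^ (q - 1) by rewrite mulr_powRB1.
have bq : b `^ q <= b * a `^ (q - 1).
  rewrite -(mulr_powRB1 b0 q0) ler_wpM2l// ge0_ler_powR ?nnegrE//; lra.
rewrite (le_trans (lerD (lexx _) bq))// -mulrDl ler_wpM2r ?powR_ge0//.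
by rewrite ler_peMl ?addr_ge0.
Qed.

Lemma spow_sqr_lip p a b : 2 <= p ->
  (spow (p / 2) a - spow (p / 2) b) ^+ 2 <=
  p ^+ 2 / 4 * (`|a - b| ^+ 2 * (`|a| `^ (p - 2) + `|b| `^ (p - 2))).
Proof.
move=> p2; have p1 : 1 <= p / 2 by lra.
have := spow_lip a b p1; set m := Num.max _ _ => h.
have m0 : 0 <= m by rewrite le_max normr_ge0.
have : (spow (p / 2) a - spow (p / 2) b) ^+ 2 <= (p / 2 * `|a - b| * m `^ (p / 2 - 1)) ^+ 2.
  rewrite -[leLHS]real_normK ?num_real// lerXn2r ?nnegrE//.
  by rewrite !mulr_ge0 ?powR_ge0//; lra.
move=> /le_trans; apply.
have -> : (p / 2 * `|a - b| * m `^ (p / 2 - 1)) ^+ 2 =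
    p ^+ 2 / 4 * (`|a - b| ^+ 2 * (m `^ (p / 2 - 1)) ^+ 2) by field.
rewrite ler_wpM2l//; first by rewrite divr_ge0 ?sqr_ge0.
rewrite ler_wpM2l ?sqr_ge0// -powR_mulrn ?powR_ge0// -powRrM.
rewrite (_ : (p / 2 - 1) * 2 = p - 2); last lra.
rewrite /m maxEle; case: ifP => _; first by rewrite lerDr powR_ge0.
by rewrite lerDl powR_ge0.
Qed.

(** A pointwise substitute for Hölder's inequality: the larger of a and b dominates. *)
Lemma sqr_powR_le p a b : 2 <= p -> 0 <= a -> 0 <= b ->
  a ^+ 2 * b `^ (p - 2) <= a `^ p + b `^ p.
Proof.
move=> p2 a0 b0; have pE : p != 0 by rewrite gt_eqF//; lra.
have key c : 0 <= c -> c ^+ 2 * c `^ (p - 2) <= c `^ p.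
  move=> c0; have [->|c_neq0] := eqVneq c 0; first by rewrite expr0n mul0r powR_ge0.
  by rewrite -powR_mulrn// -powRD ?c_neq0 ?implybT// addrC subrK.
have [ab|/ltW ba] := leP a b.
  apply: (@le_trans _ _ (b `^ p)); last by rewrite lerDr powR_ge0.
  by rewrite (le_trans _ (key b b0))// ler_wpM2r ?powR_ge0// lerXn2r.
apply: (@le_trans _ _ (a `^ p)); last by rewrite lerDl powR_ge0.
rewrite (le_trans _ (key a a0))// ler_wpM2l ?sqr_ge0//.
by rewrite ge0_ler_powR ?nnegrE//; lra.
Qed.

Lemma powR_le_exp t p : 0 <= 1 + t -> 0 <= p -> (1 + t) `^ p <= expR (p * t).
Proof.
move=> t0 p0.
apply: (@le_trans _ _ (expR t `^ p)); first by rewrite ge0_ler_powR ?nnegrE ?expR_ge0// expR_ge1Dx.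
by rewrite /powR gt_eqF ?expR_gt0// expRK.
Qed.

Lemma expR_half_ge : 3 / 2 <= expR (1 / 2) :> R.
Proof. by have := expR_ge1Dx (1 / 2 : R); lra. Qed.

Lemma expR_half_le : expR (1 / 2) <= 2 :> R.
Proof.
have := expR_ge1Dx (- (1 / 2) : R); rewrite expRN => h.
have e0 := expR_gt0 (1 / 2 : R).
by move: h; rewrite -(ler_pM2l e0) divff ?gt_eqF//; lra.
Qed.

Lemma powR_half_le q : 1 <= q -> 2^-1 `^ q <= 2^-1 :> R.
Proof.
move=> q1; have h : 0 < (2^-1 : R) <= 1 by rewrite invr_gt0 ltr0n invf_le1// ler1n.
exact: ge1r_powR.
Qed.

(** The signed powers differ by at least half the larger modulus: opposite signs add up, and a ratio
    of at least 2 remains so after raising to the power p/2 >= 1. *)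
Lemma spow_far p a b : 2 <= p -> 0 <= a -> [\/ b < 0, 2 * a < b | 2 * b < a] ->
  Num.max `|a| `|b| `^ p <= 4 * (spow (p / 2) a - spow (p / 2) b) ^+ 2.
Proof.
move=> p2 a0 far; have q1 : 1 <= p / 2 by lra.
have q0 : 0 < p / 2 by lra.
set m := Num.max _ _; have m0 : 0 <= m by rewrite le_max normr_ge0.
suff h : m `^ (p / 2) <= 2 * `|spow (p / 2) a - spow (p / 2) b|.
  have -> : m `^ p = (m `^ (p / 2)) ^+ 2.
    by rewrite -powR_mulrn ?powR_ge0// -powRrM divfK.
  rewrite -[(spow _ _ - _) ^+ 2]real_normK ?num_real//.
  have : (m `^ (p / 2)) ^+ 2 <= (2 * `|spow (p / 2) a - spow (p / 2) b|) ^+ 2.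
    by rewrite lerXn2r ?nnegrE ?powR_ge0// mulr_ge0.
  by rewrite exprMn -natrX.
have half c d : 0 <= c -> 0 <= d -> 2 * c < d -> c `^ (p / 2) <= d `^ (p / 2) / 2.
  move=> c0 d0 cd; apply: (@le_trans _ _ ((2^-1 * d) `^ (p / 2))).
    by rewrite ge0_ler_powR ?nnegrE ?mulr_ge0 ?invr_ge0//; lra.
  by rewrite powRM ?invr_ge0// mulrC ler_wpM2l ?powR_ge0// powR_half_le.
have pa := powR_ge0 a (p / 2).
rewrite /m (ger0_norm a0) (spow_pos q0 a0).
have [b0|b0] := ltP b 0.
  rewrite -[b in spow _ b]opprK spowN opprK spow_pos//; last lra.
  rewrite ltr0_norm//; have pb := powR_ge0 (- b) (p / 2).
  rewrite (ger0_norm (addr_ge0 pa pb)).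
  by rewrite maxEle; case: ifP => _; lra.
have pb := powR_ge0 b (p / 2).
rewrite (ger0_norm b0) spow_pos//.
case: far => [|ab|ba]; first by rewrite ltNge b0.
- have := half a b a0 b0 ab => h.
  rewrite (max_idPr _); last lra.
  by rewrite distrC ger0_norm; lra.
- have := half b a b0 a0 ba => h.
  rewrite (max_idPl _); last lra.
  by rewrite ger0_norm; lra.
Qed.

(* Where [a] and [b] are comparable, [b / p] has the sign of [a] and shortens it
   by a factor [1 - 1 / (2 p)]; elsewhere the signed powers are far apart. *)
Lemma spow_shrink p a b : 2 <= p ->
  `|a - b / p| `^ p <=
  2 / 3 * `|a| `^ p + 16 * (spow (p / 2) a - spow (p / 2) b) ^+ 2.
Proof.
move=> p2; wlog a0 : a b / 0 <= a.
  move=> h; have [a0|a0] := leP 0 a; first exact: h.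
  have := h (- a) (- b); rewrite !spowN mulNr -!opprD !normrN sqrrN.
  by apply; lra.
have p0 : 0 < p by lra.
have p0' : 0 <= p by lra.
have sq := sqr_ge0 (spow (p / 2) a - spow (p / 2) b).
have ap := powR_ge0 `|a| p.
have pV : 0 < p^-1 <= 2^-1 by rewrite invr_gt0 p0 lef_pV2 ?posrE.
move: pV => /andP[pV0 pV2].
have far : [\/ b < 0, 2 * a < b | 2 * b < a] ->
    `|a - b / p| `^ p <= 16 * (spow (p / 2) a - spow (p / 2) b) ^+ 2.
  move=> /(spow_far p2 a0); set m := Num.max _ _ => mp.
  have m0 : 0 <= m by rewrite le_max normr_ge0.
  have am : `|a| <= m by rewrite le_max lexx.
  have bm : `|b| <= m by rewrite le_max lexx orbT.
  apply: (@le_trans _ _ (((1 + p^-1) * m) `^ p)).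
    rewrite ge0_ler_powR ?nnegrE ?mulr_ge0//; first by rewrite addr_ge0// ltW.
    rewrite (le_trans (ler_normB _ _))// normrM (gtr0_norm pV0).
    have : `|b| * p^-1 <= m * p^-1 by rewrite ler_pM2r.
    by lra.
  rewrite powRM//; last by rewrite addr_ge0// ltW.
  (* (1 + 1/p)^p <= e <= 4; with the factor 4 of [spow_far] this makes 16. *)
  have e4 : (1 + p^-1) `^ p <= 4.
    have := @powR_le_exp p^-1 p; rewrite divff ?gt_eqF// => h.
    apply: (le_trans (h _ _)) => //; first by rewrite addr_ge0// ltW.
    have := expR_half_le; have := expR_gt0 (1 / 2 : R).
    rewrite (_ : expR 1 = expR (1 / 2) * expR (1 / 2)); last first.
      by rewrite -expRD; congr expR; lra.
    by nra.
  have mp0 := powR_ge0 m p.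
  have : (1 + p^-1) `^ p * m `^ p <= 4 * m `^ p by rewrite ler_wpM2r.
  by lra.
have [b0|b0] := ltP b 0; first by have := far (Or31 _ _ b0); lra.
have [ab|ab] := ltP (2 * a) b; first by have := far (Or32 _ _ ab); lra.
have [ba|ba] := ltP (2 * b) a; first by have := far (Or33 _ _ ba); lra.
have bp1 : b * p^-1 <= a.
  have : b * p^-1 <= (2 * a) * 2^-1 by apply: ler_pM => //; exact: ltW.
  by lra.
have bp2 : a / 2 * p^-1 <= b * p^-1 by rewrite ler_pM2r//; lra.
have {far} : `|a - b / p| `^ p <= 2 / 3 * `|a| `^ p; last lra.
apply: (@le_trans _ _ (((1 + - (2^-1 * p^-1)) * `|a|) `^ p)).
  rewrite ger0_norm ?(ger0_norm a0); last lra.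
  by rewrite ge0_ler_powR ?nnegrE//; [lra|apply: mulr_ge0 => //; lra|lra].
rewrite powRM//; last lra.
rewrite ler_wpM2r//.
(* (1 - 1/(2p))^p <= exp(-1/2) <= 2/3. *)
have := @powR_le_exp (- (2^-1 * p^-1)) p.
rewrite (_ : p * - (2^-1 * p^-1) = - (1 / 2)); last by field; rewrite gt_eqF.
rewrite expRN => h; apply: (le_trans (h _ _)) => //; first lra.
have -> : 2 / 3 = (3 / 2 : R)^-1 by field.
by rewrite lef_pV2 ?posrE ?expR_gt0// expR_half_ge.
Qed.

End signed_power.

(** * The Mazur map between L_p and L_2 *)

Section Lp_integrals.
Context {R : realType} (p : R) (p2 : 2 <= p).
Local Notation mu := (lebesgue01 R).
Local Notation Lp := (Lp (lee1_ge2 p2)).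
Implicit Types f g z : Lp.

Let p_gt0 : 0 < p. Proof. exact: lt_le_trans p2. Qed.

Lemma Lp_measurable f :
  measurable_fun setT (f : measurableTypeR R -> measurableTypeR R).
Proof. by have /sub_Lfun_mfun := Lp_Lfun f; rewrite inE. Qed.

Lemma integral_powR_norm (h : R -> R) (d : R) :
  Lnorm mu p%:E (EFin \o h) = d%:E ->
  (\int[mu]_t (`|h t| `^ p)%:E = (d `^ p)%:E)%E.
Proof.
move=> hd; have := @poweR_Lnorm _ _ _ mu (EFin \o h) p.
rewrite gt_eqF// => /(_ isT); rewrite hd => e.
by rewrite -poweR_EFin e; apply: eq_integral.
Qed.

Lemma integral_mdist f g :
  (\int[mu]_t (`|f t - g t| `^ p)%:E = (mdist f g `^ p)%:E)%E.
Proof.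
by rewrite -(@integral_powR_norm (fun t => f t - g t) (mdist f g))// -Lp_distE.
Qed.

Lemma measurable_powR_norm (h : measurableTypeR R -> measurableTypeR R) (q : R) :
  measurable_fun setT h ->
  measurable_fun setT (fun t => `|h t| `^ q : measurableTypeR R).
Proof.
move=> mh; apply: (@measurableT_comp _ _ _ _ _ _ (@powR R ^~ q)) => //.
exact: measurableT_comp.
Qed.

(** A point of L_p is evaluated through a representative chosen in its class, so h is recovered only
    almost everywhere. *)
Lemma exists_Lp (h : R -> R) : h \in Lfun mu p%:E ->
  exists c : Lp, (c : R -> R) = h %[ae mu].
Proof.
move=> hL.
have mh : measurable_fun setT (h : measurableTypeR R -> measurableTypeR R).
  by have := sub_Lfun_mfun hL; rewrite inE.
pose hm : {mfun measurableTypeR R >-> measurableTypeR R} :=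
  HB.pack (h : measurableTypeR R -> measurableTypeR R)
    (isMeasurableFun.Build _ _ (measurableTypeR R) (measurableTypeR R) h mh).
pose c0 : {mfun_ mu, measurableTypeR R >-> measurableTypeR R} :=
  (\pi_({mfun_ mu, measurableTypeR R >-> measurableTypeR R}) hm)%qT.
have c0h : (c0 : R -> R) = h %[ae mu].
  have := reprK c0; rewrite {2}/c0 => /eqP.
  by rewrite eqmodE => /asboolP.
have mc : measurable_fun setT (c0 : measurableTypeR R -> measurableTypeR R).
  exact: measurable_funPT.
have fc : finite_norm mu p%:E (c0 : measurableTypeR R -> measurableTypeR R).
  have mE (g : measurableTypeR R -> measurableTypeR R) : measurable_fun setT g ->
      measurable_fun setT (fun t => (`|(EFin \o g) t| `^ p)%E).
    move=> mg; have : measurable_fun setT (fun t => (`|g t| `^ p)%:E).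
      by apply/measurable_EFinP; exact: measurable_powR_norm.
    by [].
  have e : (\int[mu]_t (`|(EFin \o (c0 : R -> R)) t| `^ p) =
            \int[mu]_t (`|(EFin \o h) t| `^ p))%E.
    apply: ge0_ae_eq_integral => //; [exact: mE|exact: mE|..].
    - by move=> t _; exact: poweR_ge0.
    - by move=> t _; exact: poweR_ge0.
    move: c0h; by apply: (@filterS _ _ (ae_filter_ringOfSetsType mu)) => t /(_ I) /= ->.
  have : finite_norm mu p%:E h by have /sub_Lfun_finLfun := hL; rewrite inE.
  by rewrite /finite_norm unlock /Lnorm e.
pose c : Lp := HB.pack c0 (isFinLebesgue.Build _ _ _ mu p%:E (lee1_ge2 p2) c0 fc).
by exists c.
Qed.

Lemma ae_integral_powR f (c : Lp) (h : R -> R) : h \in Lfun mu p%:E ->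
  (c : R -> R) = h %[ae mu] ->
  (\int[mu]_t (`|f t - h t| `^ p)%:E = (mdist f c `^ p)%:E)%E.
Proof.
move=> hL ch; rewrite -integral_mdist.
have mh : measurable_fun setT (h : measurableTypeR R -> measurableTypeR R).
  by have := sub_Lfun_mfun hL; rewrite inE.
have mB (g : measurableTypeR R -> measurableTypeR R) : measurable_fun setT g ->
    measurable_fun setT (fun t => (`|f t - g t| `^ p)%:E).
  move=> mg; apply/measurable_EFinP; apply: measurable_powR_norm.
  by apply: measurable_funB => //; exact: Lp_measurable.
apply: ge0_ae_eq_integral; first exact: measurableT.
- exact: mB.
- by apply: mB; exact: Lp_measurable.
- by move=> t _; rewrite lee_fin powR_ge0.
- by move=> t _; rewrite lee_fin powR_ge0.
- by move: ch; apply: (@filterS _ _ (ae_filter_ringOfSetsType mu)) => t /(_ I) /= ->.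
Qed.

Lemma integral_scaled f z (r : R) : 0 < r ->
  (\int[mu]_t (`|(f t - z t) / r| `^ p)%:E = ((mdist f z / r) `^ p)%:E)%E.
Proof.
move=> r0; rewrite powRM ?mdist_ge0 ?invr_ge0 ?(ltW r0)// EFinM -integral_mdist.
have mfz : measurable_fun setT (fun t => (`|f t - z t| `^ p)%:E).
  apply/measurable_EFinP; apply: measurable_powR_norm.
  by apply: measurable_funB; exact: Lp_measurable.
rewrite -ge0_integralZr ?lee_fin ?powR_ge0//.
apply: eq_integral => t _; rewrite -EFinM normrM powRM//.
by rewrite (@ger0_norm _ r^-1)// invr_ge0 ltW.
Qed.

Definition mazur z (r : R) f : measurableTypeR R -> measurableTypeR R :=
  fun t => spow (p / 2) ((f t - z t) / r).

Lemma measurable_mazur z r f : measurable_fun setT (mazur z r f).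
Proof.
have mfz : measurable_fun setT (fun t => (f t - z t) / r : measurableTypeR R).
  apply: measurable_funM; last exact: measurable_cst.
  by apply: measurable_funB; exact: Lp_measurable.
apply: (measurableT_comp _ mfz).
apply: (@eq_measurable_fun _ _ _ _ setT (fun a : R => Num.max a 0 `^ (p / 2) -
    Num.max (- a) 0 `^ (p / 2))).
  by move=> a _; rewrite spowE// divr_gt0.
apply: measurable_funB; apply: (@measurableT_comp _ _ _ _ _ _ (@powR R ^~ (p / 2))) => //.
  by apply: measurable_maxr.
by apply: measurable_maxr.
Qed.

Lemma integral_sqr_mazur z r f : 0 < r ->
  (\int[mu]_t (mazur z r f t ^+ 2)%:E = ((mdist f z / r) `^ p)%:E)%E.
Proof.
move=> r0; rewrite -integral_scaled//; apply: eq_integral => t _; congr (_%:E).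
rewrite -real_normK ?num_real// spow_norm ?divr_gt0//.
by rewrite -powR_mulrn ?powR_ge0// -powRrM divfK.
Qed.

(** Functions, not classes: [dot] is then only semidefinite, as the Gram-Schmidt construction
    allows. *)
Definition L2 : set (measurableTypeR R -> R) := [set u | u \in Lfun mu 2%:E].

Definition dot (u v : measurableTypeR R -> R) : R := \int[mu]_t (u t * v t).

Lemma L2_lin (a : R) (u v : measurableTypeR R -> R) : L2 u -> L2 v -> L2 (a *: u + v).
Proof. by move=> u2 v2; apply: (Lfun_submod_closed mu (lee1n 2)).2. Qed.

Lemma L2_0 : L2 0.
Proof. exact: (Lfun_submod_closed mu (lee1n 2)).1. Qed.

Lemma L2_mul_integrable u v : L2 u -> L2 v ->
  mu.-integrable setT (EFin \o (fun t => u t * v t)).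
Proof. by move=> u2 v2; apply/Lfun1_integrable; exact: Lfun2_mul_Lfun1. Qed.

Lemma dotC u v : dot u v = dot v u.
Proof. by apply: eq_Rintegral => t _; rewrite mulrC. Qed.

Lemma dot_lin (a : R) (u v w : measurableTypeR R -> R) : L2 u -> L2 v -> L2 w ->
  dot (a *: u + v) w = a * dot u w + dot v w.
Proof.
move=> u2 v2 w2; rewrite /dot -RintegralZl//; last exact: L2_mul_integrable.
rewrite -RintegralD//; last 2 first.
- have au2 : L2 (a *: u) by rewrite -[a *: u]addr0; apply: L2_lin => //; exact: L2_0.
  apply: eq_integrable (L2_mul_integrable au2 w2) => // t _ /=.
  by rewrite mulrA.
- exact: L2_mul_integrable.
by apply: eq_Rintegral => t _; rewrite mulrA -mulrDl.
Qed.

Lemma dot_ge0 u : L2 u -> 0 <= dot u u.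
Proof. by move=> _; apply: Rintegral_ge0 => t _; rewrite -expr2 sqr_ge0. Qed.

Lemma dotE u : L2 u -> ((dot u u)%:E = \int[mu]_t (u t ^+ 2)%:E)%E.
Proof.
move=> u2; rewrite /dot /Rintegral fineK//.
by apply: integrable_fin_num => //; exact: L2_mul_integrable.
Qed.

Lemma L2_mazur z r f : 0 < r -> L2 (mazur z r f).
Proof.
move=> r0; apply/andP; split; rewrite inE/=; first exact: measurable_mazur.
rewrite /finite_norm unlock.
have -> : (\int[mu]_t (`|(EFin \o mazur z r f) t| `^ 2) =
           \int[mu]_t (mazur z r f t ^+ 2)%:E)%E.
  apply: eq_integral => t _ /=; congr (_%:E).
  by rewrite (powR_mulrn 2)// real_normK ?num_real.
by rewrite integral_sqr_mazur// poweR_EFin ltry.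
Qed.

Lemma dot_mazur z r f : 0 < r ->
  dot (mazur z r f) (mazur z r f) = (mdist f z / r) `^ p.
Proof. by move=> r0; apply: EFin_inj; rewrite dotE ?integral_sqr_mazur//; exact: L2_mazur. Qed.

Lemma L2_B u v : L2 u -> L2 v -> L2 (u - v).
Proof. by move=> u2 v2; rewrite addrC -scaleN1r; apply: L2_lin. Qed.

(** Bundles the side conditions of monotonicity, so that pointwise inequalities integrate by plain
    algebra. *)
Definition has_integral (h : measurableTypeR R -> measurableTypeR R) (x : R) :=
  [/\ measurable_fun setT h, forall t, 0 <= h t & (\int[mu]_t (h t)%:E = x%:E)%E].

Lemma has_integralD h k x y : has_integral h x -> has_integral k y ->
  has_integral (fun t => h t + k t) (x + y).
Proof.
move=> [mh h0 hx] [mk k0 ky]; split; first exact: measurable_funD.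
  by move=> t; rewrite addr_ge0.
under eq_integral do rewrite EFinD.
rewrite ge0_integralD//; first by rewrite hx ky.
- by move=> t _; rewrite lee_fin.
- exact/measurable_EFinP.
- by move=> t _; rewrite lee_fin.
- exact/measurable_EFinP.
Qed.

Lemma has_integralZ c h x : 0 <= c -> has_integral h x ->
  has_integral (fun t => c * h t) (c * x).
Proof.
move=> c0 [mh h0 hx]; split.
- by apply: measurable_funM => //; exact: measurable_cst.
- by move=> t; rewrite mulr_ge0.
under eq_integral do rewrite EFinM.
rewrite ge0_integralZl//; first by rewrite hx.
- exact/measurable_EFinP.
- by move=> t _; rewrite lee_fin.
Qed.

Lemma has_integral_le h k x y : has_integral h x -> has_integral k y ->
  (forall t, h t <= k t) -> x <= y.
Proof.
move=> [mh h0 hx] [mk k0 ky] hk; rewrite -lee_fin -hx -ky.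
apply: ge0_le_integral => //.
- by move=> t _; rewrite lee_fin.
- exact/measurable_EFinP.
- exact/measurable_EFinP.
- by move=> t _; rewrite lee_fin.
Qed.

Lemma has_integral_scaled f z r : 0 < r ->
  has_integral (fun t => `|(f t - z t) / r| `^ p) ((mdist f z / r) `^ p).
Proof.
move=> r0; split; last exact: integral_scaled.
  apply: measurable_powR_norm; apply: measurable_funM; last exact: measurable_cst.
  by apply: measurable_funB; exact: Lp_measurable.
by move=> t; rewrite powR_ge0.
Qed.

Lemma has_integral_mazurB z r f g : 0 < r ->
  has_integral (fun t => (mazur z r f t - mazur z r g t) ^+ 2)
    (dot (mazur z r f - mazur z r g) (mazur z r f - mazur z r g)).
Proof.
move=> r0; have mB : measurable_fun setT (fun t => mazur z r f t - mazur z r g t).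
  by apply: measurable_funB; exact: measurable_mazur.
split; first exact: measurable_funX.
  by move=> t; rewrite sqr_ge0.
by rewrite dotE//; apply: L2_B; exact: L2_mazur.
Qed.

(** With x = |f - g| / [mdist f g], of p-norm 1, [sqr_powR_le] leaves an integral of at most 2 + 4 +
    4 = 10, and 10/4 = 5/2. The bound 4 instead of 1 admits points slightly outside the ball. *)
Lemma dot_mazurB_le z r f g : 0 < r ->
  (mdist f z / r) `^ p <= 4 -> (mdist g z / r) `^ p <= 4 ->
  dot (mazur z r f - mazur z r g) (mazur z r f - mazur z r g)
  <= 5 / 2 * p ^+ 2 * (mdist f g / r) ^+ 2.
Proof.
move=> r0 fz gz; have [->|fg] := eqVneq f g.
  rewrite subrr mdistxx mul0r expr0n mulr0.
  by have := dot_lin 1 L2_0 L2_0 L2_0; rewrite scale1r addr0 mul1r; lra.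
have d0 : 0 < mdist f g by rewrite mdist_gt0.
set D := mdist f g / r; have D0 : 0 < D by rewrite divr_gt0.
have hX := has_integral_scaled f g d0.
rewrite divff ?gt_eqF// powR1 in hX.
have hY := has_integral_scaled f z r0.
have hZ := has_integral_scaled g z r0.
have c0 : 0 <= p ^+ 2 / 4 * D ^+ 2 by rewrite mulr_ge0 ?divr_ge0 ?sqr_ge0.
have hS := has_integralZ c0 (has_integralD (has_integralZ (ler0n _ 2) hX) (has_integralD hY hZ)).
apply: le_trans (has_integral_le (has_integral_mazurB z f g r0) hS _) _.
  move=> t; apply: le_trans (spow_sqr_lip _ _ p2) _.
  set a := (f t - z t) / r; set b := (g t - z t) / r.
  have -> : `|a - b| = D * `|(f t - g t) / mdist f g|.
    rewrite /a /b -mulrBl (_ : f t - z t - (g t - z t) = f t - g t); last ring.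
    rewrite !normrM (gtr0_norm (_ : 0 < r^-1)) ?invr_gt0//.
    rewrite (gtr0_norm (_ : 0 < (mdist f g)^-1)) ?invr_gt0// /D.
    by field; rewrite !gt_eqF.
  set x := `|_ / mdist f g|.
  rewrite [leRHS](_ : _ = p ^+ 2 / 4 *
    (D ^+ 2 * (2 * x `^ p + (`|a| `^ p + `|b| `^ p)))); last exact: (esym (mulrA _ _ _)).
  rewrite ler_wpM2l ?divr_ge0 ?sqr_ge0// exprMn -mulrA ler_wpM2l ?sqr_ge0//.
  have x0 : 0 <= x by exact: normr_ge0.
  have := sqr_powR_le p2 x0 (normr_ge0 a); have := sqr_powR_le p2 x0 (normr_ge0 b).
  by rewrite mulrDr; lra.
have -> : 5 / 2 * p ^+ 2 * D ^+ 2 = p ^+ 2 / 4 * D ^+ 2 * 10 by field.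
by rewrite ler_wpM2l//; lra.
Qed.

(** The centre c = (1 - 1/p) z + y/p satisfies f - c = (f - z) - (y - z)/p. Integrating
    [spow_shrink] gives at most (2/3 + 16/100) r^p, below 7/8 r^p, and 7/8 <= (1 - 1/(8p))^p by
    Bernoulli. *)
Lemma mazur_shrink z y r : 0 < r -> exists c : Lp, forall f,
  mdist f z <= r ->
  dot (mazur z r f - mazur z r y) (mazur z r f - mazur z r y) <= 1 / 100 ->
  mdist f c <= (1 - 1 / (8 * p)) * r.
Proof.
move=> r0.
have hL : ((1 - p^-1) *: (z : R -> R) + p^-1 *: (y : R -> R)) \in Lfun mu p%:E.
  apply: (Lfun_submod_closed mu (lee1_ge2 p2)).2; first exact: Lp_Lfun.
  rewrite -[p^-1 *: _]addr0; apply: (Lfun_submod_closed mu (lee1_ge2 p2)).2.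
    exact: Lp_Lfun.
  exact: (Lfun_submod_closed mu (lee1_ge2 p2)).1.
have [c ch] := exists_Lp hL; exists c => f fz fy.
have cI := ae_integral_powR f hL ch.
have pV : 0 < p^-1 <= 2^-1 by rewrite invr_gt0 p_gt0 lef_pV2 ?posrE.
move: pV => /andP[pV0 pV2].
have th : 7 / 8 <= (1 - 1 / (8 * p)) `^ p.
  have := @powR_bernoulli _ (1 - 1 / (8 * p)) p.
  rewrite (_ : p * _ = - (1 / 8)); last by field; rewrite gt_eqF.
  have -> : 1 / (8 * p) = p^-1 / 8 by field; rewrite gt_eqF.
  move=> h; apply: (le_trans _ (h _ _)); [lra|lra|by rewrite (le_trans _ p2)// ler1n].
have th0 : 0 <= (1 - 1 / (8 * p)) * r.
  by rewrite mulr_ge0 ?(ltW r0)// (_ : 1 / (8 * p) = p^-1 / 8) ?subr_ge0; [lra|field; rewrite gt_eqF].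
have key : (mdist f c) `^ p <= ((1 - 1 / (8 * p)) * r) `^ p.
  have hA := has_integral_scaled f z r0.
  have hB := has_integral_mazurB z f y r0.
  have rp : 0 <= r `^ p := powR_ge0 _ _.
  have c23 : 0 <= 2 / 3 :> R by lra.
  have hS := has_integralZ rp (has_integralD (has_integralZ c23 hA)
    (has_integralZ (ler0n _ 16) hB)).
  apply: (@le_trans _ _ (r `^ p * (2 / 3 * (mdist f z / r) `^ p + 16 *
    dot (mazur z r f - mazur z r y) (mazur z r f - mazur z r y)))).
    have hC : has_integral (fun t => `|f t - ((1 - p^-1) *: (z : R -> R) + p^-1 *: (y : R -> R)) t| `^ p)
        (mdist f c `^ p).
      split; last exact: cI.
        apply: measurable_powR_norm; apply: measurable_funB; first exact: Lp_measurable.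
        by have := sub_Lfun_mfun hL; rewrite inE.
      by move=> t; exact: powR_ge0.
    apply: has_integral_le hC hS _.
    move=> t.
    have -> : `|f t - ((1 - p^-1) *: (z : R -> R) + p^-1 *: (y : R -> R)) t| =
        r * `|(f t - z t) / r - (y t - z t) / r / p|.
      rewrite -[X in X * _](gtr0_norm r0) -normrM; congr (`|_|).
      rewrite -[((1 - p^-1) *: (z : R -> R) + _) t]/((1 - p^-1) * z t + p^-1 * y t).
      by field; rewrite !gt_eqF.
    by rewrite powRM ?(ltW r0)// ler_wpM2l// spow_shrink.
  rewrite [leRHS]powRM ?(ltW r0)//; last first.
    by rewrite (_ : 1 / (8 * p) = p^-1 / 8) ?subr_ge0; [lra|field; rewrite gt_eqF].
  rewrite [leRHS]mulrC ler_wpM2l//.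
  have : (mdist f z / r) `^ p <= 1.
    have e1 : 1 `^ p = 1 :> R by rewrite powR1.
    rewrite -e1 ge0_ler_powR ?nnegrE ?divr_ge0 ?mdist_ge0 ?(ltW r0) ?(ltW p_gt0)//.
    by rewrite ler_pdivrMr// mul1r.
  by lra.
rewrite leNgt; apply/negP => /(gt0_ltr_powR p_gt0).
rewrite !nnegrE mdist_ge0 th0 => /(_ isT isT).
by rewrite ltNge key.
Qed.

End Lp_integrals.

(** * Local partitions of a ball of L_p *)

Lemma sqrB_le2 (R : realDomainType) (a b c : R) :
  (a - c) ^+ 2 <= 2 * (a - b) ^+ 2 + 2 * (c - b) ^+ 2.
Proof.
rewrite -subr_ge0 (_ : _ - _ = (a + c - 2 * b) ^+ 2) ?sqr_ge0//; ring.
Qed.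

Lemma sqrtrM_le (R : rcfType) (c k x : R) : 0 <= k -> 0 <= x -> c <= k ^+ 2 ->
  Num.sqrt (c * x) <= k * Num.sqrt x.
Proof.
move=> k0 x0 ck; rewrite -[k in leRHS]ger0_norm// -sqrtr_sqr -sqrtrM ?sqr_ge0//.
by rewrite ler_wsqrtr// ler_wpM2r.
Qed.

Section Lp_local_partition.
Context {R : realType} (p : R) (p2 : 2 <= p).
Local Notation mu := (lebesgue01 R).
Local Notation Lp := (Lp (lee1_ge2 p2)).

Lemma Lp_local_partition (S : set Lp) z (r : R) n (y : 'I_n.+1 -> Lp) : 0 < r ->
  (forall x, S x -> mdist x z <= r) ->
  (forall x, S x -> exists i, mdist x (y i) <= r / (100 * p)) ->
  local_partition S n.+1 ((1 - 1 / (8 * p)) * r)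
    (40 * 960 * p * Num.sqrt (ln (2 * n.+1%:R)) / r).
Proof.
move=> r0 Sz Sy.
have p0 : 0 < p := lt_le_trans (ltr0n _ 2) p2.
pose U (x : Lp) : measurableTypeR R -> R := mazur z r x.
have U2 (x : Lp) : L2 (U x) by exact: L2_mazur.
(* 1/250 is the squared decoding radius in L_2: it exceeds eight times the squared approximation
   error 1/4000, and twice the sum of both stays below the 1/100 of [mazur_shrink]. *)
have d0 : 0 < 1 / 250 :> R by lra.
have num : 2 * (1 / 4000) + 2 * (1 / 250) <= 1 / 100 :> R by lra.
have c600 : 1152 / (1 / 250) <= 600 ^+ 2 :> R by lra.
have num8 : 8 * (1 / 4000) <= 1 / 250 :> R by lra.
have [phi [phi0 phi1 phis phil]] := hilbert_partition L2_0 (@L2_lin R)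
  (@dotC R) (@dot_lin R) (@dot_ge0 R) (fun j => U2 (y j)) d0.
have /choice[c cP] := fun j => mazur_shrink z (y j) r0.
have e1 : 1 `^ p = 1 :> R by rewrite powR1.
have dz x : S x -> (mdist x z / r) `^ p <= 1.
  move=> Sx; rewrite -[leRHS]e1 ge0_ler_powR ?nnegrE ?divr_ge0 ?mdist_ge0 ?(ltW r0) ?(ltW p0)//.
  by rewrite ler_pdivrMr// mul1r Sz.
have U1 x : S x -> dot (U x) (U x) <= 1 by move=> Sx; rewrite dot_mazur// dz.
have near x i : S x -> mdist x (y i) <= r / (100 * p) ->
    dot (U x - U (y i)) (U x - U (y i)) <= 1 / 4000.
  move=> Sx xy; apply: (le_trans (dot_mazurB_le r0 _ _)).
  - by rewrite (le_trans (dz _ Sx))// ler1n.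
  (* [y i] may leave the ball by r/(100p); at the power p this costs at most exp(1/100). *)
  - apply: (@le_trans _ _ ((1 + 1 / (100 * p)) `^ p)).
      rewrite ge0_ler_powR ?nnegrE ?divr_ge0 ?mdist_ge0 ?(ltW r0) ?(ltW p0)//.
        by rewrite addr_ge0// divr_ge0// mulr_ge0// ltW.
      rewrite ler_pdivrMr//.
      rewrite (_ : (1 + 1 / (100 * p)) * r = r + r / (100 * p)); last first.
        by field; rewrite gt_eqF.
      rewrite (le_trans (metric_triangle _ x _))// addrC lerD ?Sz//.
      by rewrite metric_sym.
    apply: (le_trans (powR_le_exp _ (ltW p0))).
      by rewrite addr_ge0// divr_ge0// mulr_ge0// ltW.
    rewrite (_ : p * _ = 1 / 100); last by field; rewrite gt_eqF.
    apply: (le_trans _ (_ : 2 <= 4)); last lra.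
    apply: (le_trans _ expR_half_le); rewrite ler_expR; lra.
  have : mdist x (y i) / r <= 1 / (100 * p).
    by rewrite ler_pdivrMr// mulrAC mul1r.
  move: (mdist x (y i)) (mdist_ge0 x (y i)) => d d0' /(fun h => lerXn2r 2 _ _ h) h.
  have {}h : (d / r) ^+ 2 <= (1 / (100 * p)) ^+ 2.
    by apply: h; rewrite nnegrE divr_ge0 ?mulr_ge0 ?(ltW r0) ?(ltW p0).
  apply: (@le_trans _ _ (5 / 2 * p ^+ 2 * (1 / (100 * p)) ^+ 2)).
    by rewrite ler_wpM2l// mulr_ge0 ?sqr_ge0//; lra.
  by rewrite le_eqVlt; apply/orP; left; apply/eqP; field; rewrite gt_eqF.
exists (fun x => phi (U x)), c; split.
- by move=> x j _; exact: phi0.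
- by move=> x Sx; apply: phi1 => //; exact: U1.
- move=> x j Sx pj; apply: cP; first exact: Sz.
  have [i /(near _ _ Sx) xi] := Sy x Sx.
  have ji : dot (U (y j) - U (y i)) (U (y j) - U (y i)) <= 1 / 250.
    apply: (phis _ i j (U2 x) (U1 x Sx) _ pj).
    by apply: le_trans num8; rewrite ler_wpM2l.
  have h1 := has_integral_mazurB z x (y i) r0.
  have h2 := has_integral_mazurB z (y j) (y i) r0.
  have h3 := has_integral_mazurB z x (y j) r0.
  have hs := has_integralD (has_integralZ (ler0n R 2) h1) (has_integralZ (ler0n R 2) h2).
  apply: (le_trans (has_integral_le h3 hs _)).
    by move=> t; exact: sqrB_le2.
  have h2' : (0:R) <= 2 by [].
  apply: (le_trans (lerD (ler_wpM2l h2' xi) (ler_wpM2l h2' ji))).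
  exact: num.
- move=> x w Sx Sw; have [->|xw] := eqVneq x w.
    by rewrite mdistxx mulr0 big1// => j _; rewrite subrr normr0.
  have d'0 : 0 < mdist x w by rewrite mdist_gt0.
  (* 2 bounds sqrt(5/2); the final constant is 32 times 2 times 600 = 40 times 960. *)
  pose D := 2 * p * (mdist x w / r).
  have D0 : 0 < D by rewrite mulr_gt0 ?divr_gt0// mulr_gt0.
  have UD : dot (U x - U w) (U x - U w) <= D ^+ 2.
    apply: (le_trans (dot_mazurB_le r0 _ _)); rewrite ?(le_trans (dz _ _)) ?ler1n//.
    rewrite /D [leRHS]exprMn ler_wpM2r ?sqr_ge0// [leRHS]exprMn ler_wpM2r ?sqr_ge0//.
    by rewrite -natrX ler_pdivrMr// -natrM ler_nat.
  apply: (le_trans (phil _ _ _ (U2 x) (U1 x Sx) (U2 w) (U1 w Sw) D0 UD)).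
  set L := ln _; have L0 : 0 <= L by rewrite ln_ge0// mulr_ege1// ler1n.
  have sq : Num.sqrt (1152 * L / (1 / 250)) <= 600 * Num.sqrt L.
    by rewrite mulrAC; exact: (sqrtrM_le (ler0n R 600) L0 c600).
  apply: (@le_trans _ _ (32 * (D * (600 * Num.sqrt L)))).
    by rewrite ler_wpM2l// ler_wpM2l// ltW.
  rewrite /D le_eqVlt; apply/orP; left; apply/eqP; field; rewrite gt_eqF//.
Qed.

End Lp_local_partition.

(** * Nets and first clusters in doubling sets *)

Section maximal_clique.
Context {T : Type} (C : T -> T -> Prop).
Hypothesis Csym : forall x y, C x y -> C y x.

Definition clique (F : set T) := forall x y, F x -> F y -> x <> y -> C x y.

Lemma maximal_clique : exists F, clique F /\
  forall x, (forall y, F y -> x <> y -> C x y) -> F x.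
Proof.
have [|F [cF Fmax]] := @Zorn_bigcup T clique.
  move=> A cA Atot x y [F AF Fx] [G AG Gy] xy.
  have [FG|GF] := Atot F G AF AG.
    exact: (cA G AG) (FG _ Fx) Gy xy.
  exact: (cA F AF) Fx (GF _ Gy) xy.
exists F; split=> // x xF; apply: contrapT => Fx.
apply: (Fmax (F `|` [set x])).
  by split=> [y Fy|FS]; [left|apply: Fx; apply: FS; right].
move=> y z [Fy|->] [Fz|->] yz //.
- exact: cF.
- by apply: Csym; apply: xF => // xy; apply: yz.
- exact: xF.
Qed.

End maximal_clique.

Section doubling.
Context {R : realType} {M : metricType R} (D : set M) (lambda : R).
Hypothesis dD : doubling (set_type D) lambda.
Let l := Num.truncn lambda.

Lemma doubling_iter m (x : M) (r : R) : 0 <= r -> D x ->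
  exists s : seq M, [/\ (size s <= l ^ m)%N, forall y, y \in s -> D y &
    forall w, D w -> mdist x w <= 2 ^+ m * r -> exists2 y, y \in s & mdist y w <= r].
Proof.
move=> r0; elim: m x => [x Dx|m IH x Dx].
  exists [:: x]; split=> // [y|w _].
    by rewrite inE => /eqP ->.
  by rewrite mul1r; exists x => //; rewrite inE.
have r20 : 0 <= 2 ^+ m * r by rewrite mulr_ge0// exprn_ge0.
have [y yP] := dD (SigSub (mem_set Dx)) r20.
have /choice[s sP] := fun i => IH (set_val (y i)) (set_valP (y i)).
exists (flatten [seq s i | i <- enum 'I_l]); split.
- rewrite size_flatten /shape -map_comp sumnE big_map big_enum/=.
  apply: (@leq_trans (\sum_(i < l) l ^ m)).
    by apply: leq_sum => i _; have [] := sP i.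
  by rewrite sum_nat_const card_ord expnS.
- move=> z /flattenP[_ /mapP[i _ ->] zs]; have [_ + _] := sP i; exact.
- move=> w Dw; rewrite exprS -mulrA => xw.
  have [] := yP (SigSub (mem_set Dw)); first exact: xw.
  move=> i _ yw; have [_ _ /(_ w Dw yw)[z zs zw]] := sP i.
  by exists z => //; apply/flattenP; exists (s i) => //; apply/mapP; exists i => //; rewrite mem_enum.
Qed.

(** As 8a = 2^5 (a/4), five halvings give l^5 balls of radius a/4, none of which holds two points
    more than a apart. *)
Lemma doubling_packing (a : R) (d : M) (f : 'I_(l ^ 5).+1 -> M) : 0 < a -> D d ->
  (forall c, D (f c)) -> (forall c, mdist d (f c) <= 8 * a) ->
  ~ (forall c c', c != c' -> a < mdist (f c) (f c')).
Proof.
move=> a0 Dd Df df sep.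
have a4 : 0 <= a / 4 by rewrite divr_ge0// ltW.
have [s [ss _ sP]] := doubling_iter 5 a4 Dd.
have /choice[g gP] : forall c, exists y, y \in s /\ mdist y (f c) <= a / 4.
  move=> c; have [||y ys yc] := sP (f c); first exact: Df.
    by apply: (le_trans (df c)); rewrite (_ : 2 ^+ 5 * (a / 4) = 8 * a); [|field].
  by exists y.
have ginj : injective g.
  move=> c c' gcc; apply/eqP; apply: contraT => /sep.
  have [_ h1] := gP c; have [_ h2] := gP c'; rewrite gcc in h1.
  have := metric_triangle (f c) (g c') (f c'); rewrite (metric_sym (f c) (g c')).
  by lra.
have := @uniq_leq_size _ [seq g c | c <- enum 'I_(l ^ 5).+1] s.
rewrite map_inj_uniq ?enum_uniq// size_map size_enum_ord => /(_ isT) h.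
have : ((l ^ 5).+1 <= size s)%N.
  by apply: h => _ /mapP[c _ ->]; have [] := gP c.
by move=> /leq_trans /(_ ss); rewrite ltnn.
Qed.

(* Points of one colour are so far apart that their bumps of radius [4 * a] do not
   overlap; finitely many colours suffice by the packing bound. *)
Lemma colored_net (a : R) : 0 < a -> exists F : M -> 'I_(l ^ 5).+1 -> Prop,
  [/\ forall x c, F x c -> D x,
      forall x y c c', F x c -> F y c' -> x <> y -> a < mdist x y,
      forall x y c, F x c -> F y c -> x <> y -> 8 * a < mdist x y &
      forall d, D d -> exists x c, F x c /\ mdist d x <= a].
Proof.
move=> a0; set Q := (l ^ 5).+1.
pose C (p q : set_type D * 'I_Q) := a < mdist (set_val p.1) (set_val q.1) /\
  (p.2 = q.2 -> 8 * a < mdist (set_val p.1) (set_val q.1)).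
have Csym p q : C p q -> C q p.
  by move=> [h1 h2]; rewrite /C metric_sym; split=> // /esym.
have [F [cF Fmax]] := maximal_clique Csym.
exists (fun x c => exists2 Dx : D x, F (SigSub (mem_set Dx), c) & True); split.
- by move=> x c [].
- move=> x y c c' [Dx Fx _] [Dy Fy _] xy.
  by have [] := cF _ _ Fx Fy (fun e => xy (congr1 (fun p => set_val p.1) e)).
- move=> x y c [Dx Fx _] [Dy Fy _] xy.
  by have [_ /(_ erefl)] := cF _ _ Fx Fy (fun e => xy (congr1 (fun p => set_val p.1) e)).
- move=> d Dd; apply: contrapT => far.
  have farP q : F q -> a < mdist d (set_val q.1).
    move=> Fq; rewrite ltNge; apply/negP => dq; apply: far.
    exists (set_val q.1), q.2; split=> //; exists (set_valP q.1) => //.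
    rewrite (_ : (_, _) = q)//; case: q Fq {dq} => x c _ /=; congr (_, _).
    exact: val_inj.
  have [c cfree] : exists c, forall q, F q -> q.2 = c -> 8 * a < mdist d (set_val q.1).
    (* Otherwise each colour is blocked by a net point within 8a of d; these [Q] points are pairwise
       more than a apart, one more than packing permits. *)
    apply: contrapT => nfree.
    have /choice[f fP] : forall c, exists q, [/\ F q, q.2 = c & mdist d (set_val q.1) <= 8 * a].
      move=> c; apply: contrapT => nq; apply: nfree; exists c => q Fq qc.
      by rewrite ltNge; apply/negP => dq; apply: nq; exists q.
    apply: (@doubling_packing a d (fun c => set_val (f c).1)) => //.
    - by move=> c; exact: set_valP.
    - by move=> c; have [] := fP c.
    - move=> c c' cc'; have [Fc ec _] := fP c; have [Fc' ec' _] := fP c'.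
      have ne : f c <> f c' by move=> e; move/eqP: cc'; apply; rewrite -ec -ec' e.
      by have [] := cF _ _ Fc Fc' ne.
  have Fd : F (SigSub (mem_set Dd), c).
    apply: Fmax => q Fq _; split=> /=; first exact: farP.
    by move=> e; apply: cfree.
  by have := farP _ Fd; rewrite /= mdistxx ltNge (ltW a0).
Qed.

(** Labels in [gentle] are natural numbers, so nets must be enumerated. A net point is coded by some
    k such that 2^k a bounds its distance to d, and by the position of a nearby point in a finite
    a/4-net of that ball. *)
Lemma separated_countable (a : R) (F : set M) : 0 < a -> F `<=` D ->
  (forall x y, F x -> F y -> x <> y -> a < mdist x y) ->
  exists g : M -> nat, forall x y, F x -> F y -> g x = g y -> x = y.
Proof.
move=> a0 FD Fsep; have [[d Dd]|D0] := pselect (exists d, D d); last first.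
  by exists (fun=> 0%N) => x y /FD Dx; case: D0; exists x.
have a4 : 0 <= a / 4 by rewrite divr_ge0// ltW.
have /choice[s sP] := fun k => doubling_iter k.+2 a4 Dd.
have /choice[g gP] : forall x, exists ky : nat * nat,
    F x -> mdist (nth d (s ky.1) ky.2) x <= a / 4.
  move=> x; have [Fx|] := pselect (F x); last by exists (0, 0)%N.
  (* [mdist d x] <= k a <= 2^k a, and k + 2 halvings lead to a/4. *)
  pose k := (Num.truncn (mdist d x / a)).+1.
  have [_ _ /(_ x (FD _ Fx))[]] := sP k.
    rewrite (_ : _ * _ = 2 ^+ k * a); last by rewrite !exprS; field.
    have h := truncnS_gt (mdist d x / a); rewrite -/k ltr_pdivrMr// in h.
    apply: (le_trans (ltW h)); rewrite ler_wpM2r ?(ltW a0)//.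
    by rewrite -natrX ler_nat ltnW// ltn_expl.
  move=> y ys yx; exists (k, index y (s k)) => _ /=.
  by rewrite nth_index.
exists (fun x => pickle (g x)) => x y Fx Fy /(pcan_inj pickleK) gxy.
apply: contrapT => /(Fsep x y Fx Fy).
have h1 := gP x Fx; have h2 := gP y Fy; rewrite gxy in h1.
have := metric_triangle x (nth d (s (g y).1) (g y).2) y; rewrite (metric_sym x (nth _ _ _)).
by lra.
Qed.

(** Normalised bumps max(4a - [mdist x z], 0) around the net points z. Colours are the indices and
    the label names z, as at most one bump per colour is nonzero at x. Some z is within 2a of x, so
    the bumps sum to at least a. *)
Lemma gentle_doubling (S : set M) (x0 : M) (a : R) : 0 < a ->
  (forall x, S x -> exists2 d, D d & mdist d x <= a) ->
  gentle S (4 * a) (4 * ((l ^ 5).+1)%:R / a).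
Proof.
move=> a0 SD; set Q := (l ^ 5).+1.
have [F [FD Fsep Fsep8 Fnet]] := colored_net a0.
have [g gP] := @separated_countable a [set x | exists c, F x c] a0
  (fun x h => let: ex_intro c Fxc := h in FD x c Fxc)
  (fun x y h1 h2 => let: ex_intro c Fx := h1 in let: ex_intro c' Fy := h2 in
     Fsep x y c c' Fx Fy).
have /choice[near nearP] : forall cx : 'I_Q * M, exists o : option M,
    if o is Some z then F z cx.1 /\ mdist cx.2 z < 4 * a
    else forall z, F z cx.1 -> 4 * a <= mdist cx.2 z.
  move=> [c x] /=; have [[z zP]|none] := pselect (exists z, F z c /\ mdist x z < 4 * a).
    by exists (Some z).
  exists None => z Fz; rewrite leNgt; apply/negP => xz; apply: none; by exists z.
have /choice[ctr ctrP] : forall cn : 'I_Q * nat, exists z,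
    forall z', F z' cn.1 -> g z' = cn.2 -> z = z'.
  move=> [c n] /=; have [[z [Fz gz]]|none] := pselect (exists z, F z c /\ g z = n).
    exists z => z' Fz' gz'; apply: gP; [by exists c|by exists c|by rewrite gz gz'].
  (* Labels that name no net point of this colour get the default centre x0. *)
  by exists x0 => z' Fz' gz'; case: none; exists z'.
pose b c x := if near (c, x) is Some z then 4 * a - mdist x z else 0.
pose lab c x := if near (c, x) is Some z then g z else 0%N.
have b0 c x : 0 <= b c x.
  by rewrite /b; have := nearP (c, x); case: (near _) => // z [_ /= xz]; rewrite subr_ge0 ltW.
have bsum x : S x -> a <= \sum_c b c x.
  move=> /SD[d Dd dx]; have [z [c [Fz dz]]] := Fnet d Dd.
  have xz : mdist x z <= 2 * a.
    by have := metric_triangle x d z; rewrite (metric_sym x d); lra.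
  rewrite (bigD1 c)//= -[leLHS]addr0 lerD// ?sumr_ge0//.
  have := nearP (c, x); rewrite /b; case: (near _) => [z' [/= Fz' xz']|/= /(_ z Fz)]; last by lra.
  have [<-|zz'] := pselect (z = z'); first by lra.
  have := Fsep8 _ _ _ Fz Fz' zz'; have := metric_triangle z x z'.
  by rewrite (metric_sym z x); lra.
have apart c x z : F z c -> mdist x z < 4 * a ->
    (forall z', F z' c -> z' <> z -> 4 * a <= mdist x z').
  move=> Fz xz z' Fz' zz'; have := Fsep8 _ _ _ Fz' Fz zz'.
  by have := metric_triangle z' x z; rewrite (metric_sym z' x); lra.
have blip c x y : ldist (lab c x == lab c y) (b c x) (b c y) <= 2 * mdist x y.
  have d0 := mdist_ge0 x y.
  (* Leaving the bump of z between u and w takes at least the distance given by its height at u. *)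
  have oneside u w z : F z c -> mdist u z < 4 * a -> 4 * a <= mdist w z ->
      4 * a - mdist u z <= mdist u w.
    by move=> _ _ wz; have := metric_triangle w u z; rewrite (metric_sym w u); lra.
  have bx := b0 c x; have bby := b0 c y.
  rewrite /ldist /lab /b; move: bx bby; rewrite /b.
  have := nearP (c, x); have := nearP (c, y).
  case: (near (c, y)) => [w [/= Fw yw]|/= ny]; case: (near (c, x)) => [z [/= Fz xz]|/= nx] bx bby.
  - have [e|ne] := eqVneq (g z) (g w).
      have -> : w = z by apply: gP; [by exists c|by exists c|].
      rewrite ler_norml; have := metric_triangle x y z; have := metric_triangle y x z.
      by rewrite (metric_sym y x) => h1 h2; apply/andP; split; lra.
    have zw : z <> w by move=> e; rewrite e eqxx in ne.
    have := oneside x y z Fz xz (apart c y w Fw yw z Fz zw).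
    have := oneside y x w Fw yw (apart c x z Fz xz w Fw (fun e => zw (esym e))).
    by rewrite (metric_sym y x); lra.
  - have := oneside y x w Fw yw (nx w Fw); rewrite (metric_sym y x).
    by case: ifP => _; rewrite ?sub0r ?normrN ?ger0_norm//; lra.
  - have := oneside x y z Fz xz (ny z Fz).
    by case: ifP => _; rewrite ?subr0 ?ger0_norm//; lra.
  - by rewrite ?eqxx /= subrr normr0; lra.
exists 'I_Q, (fun c x => b c x / \sum_c' b c' x), lab, (fun c n => ctr (c, n)); split.
- by move=> c x _; rewrite divr_ge0// sumr_ge0.
- by move=> x Sx; rewrite -mulr_suml divff// gt_eqF// (lt_le_trans a0)// bsum.
- move=> c x Sx; have B0 : 0 < \sum_c' b c' x by rewrite (lt_le_trans a0)// bsum.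
  rewrite pmulr_lgt0 ?invr_gt0//.
  have := nearP (c, x); have := ctrP (c, lab c x); rewrite /b /lab.
  case: (near _) => [z /= zP [Fz xz] _|_ _]; last by rewrite ltxx.
  by rewrite (zP z Fz erefl) ltW.
- move=> x y Sx Sy.
  rewrite (_ : 4 * Q%:R / a * mdist x y = 2 * (Q%:R * (2 * mdist x y)) / a); last first.
    by field; rewrite gt_eqF.
  apply: ldist_normalize => //; [exact: bsum|exact: bsum|].
  apply: (@le_trans _ _ (\sum_(c < Q) 2 * mdist x y)).
    by apply: ler_sum => c _; exact: blip.
  by rewrite sumr_const card_ord [leRHS]mulr_natl.
Qed.

End doubling.

(** * Descent through the scales *)

Lemma expr_le_eventually (R : realType) (t e : R) : 0 < t < 1 -> 0 < e ->
  exists m, t ^+ m <= e.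
Proof.
move=> /andP[t0 t1] e0.
have : (fun n => t ^+ n) @ \oo --> 0 by apply: cvg_expr; rewrite gtr0_norm.
move=> /cvgrPdist_le /(_ e e0) [m _ /(_ m (leqnn m))] /=.
by rewrite sub0r normrN ger0_norm ?exprn_ge0 ?(ltW t0)// => h; exists m.
Qed.

Lemma gentle_le (R : realType) (M : metricType R) (S : set M) (r L L' : R) :
  L <= L' -> gentle S r L -> gentle S r L'.
Proof.
move=> LL' [I [psi [lab [ctr [h1 h2 h3 h4]]]]]; exists I, psi, lab, ctr; split=> //.
by move=> x y Sx Sy; rewrite (le_trans (h4 _ _ Sx Sy))// ler_wpM2r// mdist_ge0.
Qed.

Section multiscale.
Context {R : realType} (p : R) (p2 : 2 <= p).
Local Notation Lp := (Lp (lee1_ge2 p2)).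
Variables (S : set Lp) (s : R) (n : nat).
Hypothesis s0 : 0 < s.

(** n does not depend on the scale r >= s, so the cost of a step depends on the scale only through
    1/r. *)
Definition locally_covered := forall r (z : Lp), s <= r -> exists y : 'I_n.+1 -> Lp,
  forall x, S x -> mdist x z <= r -> exists i, mdist x (y i) <= r / (100 * p).

Hypothesis cov : locally_covered.

Let p0 : 0 < p. Proof. exact: lt_le_trans p2. Qed.

Definition shrink : R := 1 - 1 / (8 * p).

Definition step_cost : R := 40 * 960 * p * Num.sqrt (ln (2 * n.+1%:R)).

Lemma shrink_itv : 0 < shrink < 1.
Proof.
rewrite /shrink ltrBlDr ltrDl divr_gt0 ?mulr_gt0// andbT subr_gt0 ltr_pdivrMr ?mulr_gt0//.
by have := p2; lra.
Qed.

Lemma step_cost_gt0 : 0 < step_cost.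
Proof.
have n1 : 1 <= n.+1%:R :> R by rewrite ler1n.
apply: mulr_gt0; last by rewrite sqrtr_gt0 ln_gt0//; lra.
by apply: mulr_gt0; [apply: mulr_gt0; rewrite ltr0n|exact: p0].
Qed.

(** The step from radius r costs [step_cost / r]; over the radii s / shrink^j this is a geometric
    series, with 1/(1 - shrink) = 8p. *)
Lemma gentle_descend m L : gentle S (s / shrink ^+ m) L ->
  gentle S s (L + step_cost / s * (8 * p) * (1 - shrink ^+ m)).
Proof.
have /andP[t0 t1] := shrink_itv; have A0 := step_cost_gt0.
elim: m L => [|m IH] L; first by rewrite expr0 divr1 subrr mulr0 addr0.
move=> h; set r := s / shrink ^+ m.+1 in h.
have tm0 : 0 < shrink ^+ m.+1 by rewrite exprn_gt0.
have r0 : 0 < r by rewrite divr_gt0.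
have sr : s <= r.
  by rewrite ler_pdivlMr// ler_piMr ?(ltW s0)// exprn_ile1// ltW.
have {h} : gentle S (shrink * r) (L + step_cost / r).
  apply: gentle_refine h _; first by rewrite divr_ge0 ?ltW.
  move=> z; have [y yP] := cov z sr.
  apply: (@Lp_local_partition R p p2 _ z r n y) => //.
    by move=> x [].
  by move=> x [Sx xz]; apply: yP.
have -> : shrink * r = s / shrink ^+ m.
  by rewrite /r exprS; field; rewrite !gt_eqF ?exprn_gt0.
move=> /IH; apply: gentle_le.
rewrite -addrA lerD2l.
have -> : step_cost / r = step_cost / s * shrink ^+ m.+1.
  by rewrite /r; field; rewrite !gt_eqF.
rewrite -[X in _ + X <= _]mulrA -[leRHS]mulrA -mulrDr ler_wpM2l ?divr_ge0 ?(ltW A0) ?(ltW s0)//.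
have pE : 8 * p * (1 - shrink) = 1 by rewrite /shrink; field; rewrite gt_eqF.
have tm : 0 <= shrink ^+ m by rewrite exprn_ge0// ltW.
have tms : shrink ^+ m.+1 <= shrink ^+ m by rewrite exprS ler_piMl// ltW.
rewrite (_ : 8 * p * (1 - shrink ^+ m.+1) =
  8 * p * (1 - shrink ^+ m) + 8 * p * (1 - shrink) * shrink ^+ m); last by rewrite exprS; ring.
by rewrite pE mul1r addrC lerD2l.
Qed.

Lemma gentle_multiscale L0 R1 : 0 <= L0 ->
  (forall r, R1 <= r -> gentle S r (L0 / r)) ->
  gentle S s (16 * p * step_cost / s).
Proof.
move=> L00 start; have /andP[t0 t1] := shrink_itv.
move: step_cost step_cost_gt0 gentle_descend => A A0 descend.
(* [e1] brings the initial radius above R1, [e2] the initial cost below the bound for the series,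
   whence 16 = 8 + 8; the added 1 keeps the denominators positive. *)
pose e1 := s / (`|R1| + 1).
pose e2 := A * (8 * p) / (L0 + 1).
have e10 : 0 < e1 by rewrite divr_gt0// ltr_wpDl.
have e20 : 0 < e2 by rewrite divr_gt0 ?ltr_wpDl// !mulr_gt0.
have [m] : exists m, shrink ^+ m <= Num.min e1 e2.
  by apply: expr_le_eventually; rewrite ?shrink_itv// lt_min e10.
rewrite le_min => /andP[m1 m2].
have tm0 : 0 < shrink ^+ m by rewrite exprn_gt0.
have /descend : gentle S (s / shrink ^+ m) (L0 / (s / shrink ^+ m)).
  apply: start; rewrite ler_pdivlMr//.
  apply: (@le_trans _ _ ((`|R1| + 1) * e1)).
    apply: (@le_trans _ _ ((`|R1| + 1) * shrink ^+ m)).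
      by rewrite ler_wpM2r ?(ltW tm0)// (le_trans (ler_norm _))// lerDl.
    by rewrite ler_wpM2l// addr_ge0.
  by rewrite /e1 mulrC divfK// gt_eqF// ltr_wpDl.
apply: gentle_le.
have h1 : L0 / (s / shrink ^+ m) <= A / s * (8 * p).
  have -> : L0 / (s / shrink ^+ m) = L0 * shrink ^+ m / s.
    by field; rewrite !gt_eqF.
  rewrite [leRHS]mulrAC ler_wpM2r ?invr_ge0 ?(ltW s0)//.
  apply: (@le_trans _ _ (L0 * e2)); first by rewrite ler_wpM2l.
  rewrite /e2 mulrCA ler_piMr ?mulr_ge0 ?(ltW A0) ?(ltW p0)//.
  by rewrite ler_pdivrMr ?ltr_wpDl// mul1r lerDl.
have h2 : A / s * (8 * p) * (1 - shrink ^+ m) <= A / s * (8 * p).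
  rewrite ler_piMr ?gerBl ?(ltW tm0)//.
  by rewrite !mulr_ge0 ?invr_ge0 ?(ltW A0) ?(ltW p0) ?(ltW s0).
rewrite (_ : 16 * p * A / s = A / s * (8 * p) + A / s * (8 * p)).
  exact: lerD.
by field; rewrite gt_eqF.
Qed.

End multiscale.

(** 64 = 2 times 16 times 2: sampling, the series, and s = Delta/2. *)
Lemma SEP_multiscale (R : realType) (p : R) (p2 : 2 <= p) (S : set (Lp (lee1_ge2 p2)))
    (Delta : R) n L0 R1 : 0 < Delta -> locally_covered S (Delta / 2) n ->
    0 <= L0 -> (forall r, R1 <= r -> gentle S r (L0 / r)) ->
  (SEP (set_type S) Delta <= (64 * p * step_cost p n)%:E)%E.
Proof.
move=> D0 cov L00 start; have D20 : 0 < Delta / 2 by rewrite divr_gt0.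
have p0 : 0 < p := lt_le_trans (ltr0n _ 2) p2.
have := gentle_multiscale D20 cov L00 start.
move: (step_cost p n) (step_cost_gt0 p2 n) => A A0 g.
apply: (le_trans (SEP_gentle D0 _ g)).
  by rewrite !mulr_ge0 ?invr_ge0 ?(ltW A0) ?(ltW p0) ?(ltW D20).
rewrite lee_fin le_eqVlt; apply/orP; left; apply/eqP.
by field; rewrite gt_eqF.
Qed.

(** * Finite sets and doubling sets *)

Section theorem_bounds.
Context {R : realType} (p : R) (p2 : 2 <= p).
Local Notation Lp := (Lp (lee1_ge2 p2)).

Let p0 : 0 < p. Proof. exact: lt_le_trans p2. Qed.

Lemma near_le_double (Delta r : R) : Delta / 2 <= r ->
  (1 / 400) / p * Delta <= r / (200 * p).
Proof.
move=> h; have -> : r / (200 * p) = (1 / 200) / p * r by field; rewrite gt_eqF.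
have pV : 0 < p^-1 by rewrite invr_gt0.
have -> : 1 / 400 / p * Delta = 1 / 200 / p * (Delta / 2) by field; rewrite gt_eqF.
apply: ler_wpM2l h; apply: divr_ge0; last exact: ltW.
by apply: divr_ge0; [exact: ler01|exact: ler0n].
Qed.

(** A point of the neighbourhood is within r/(200p) of A, and A is approximated equally well, which
    adds up to r/(100p). The displacement is at most r, hence the ball of radius 2r. *)
Lemma nbhd_covered (A : set Lp) (Delta : R) n : 0 < Delta ->
  (forall r (z : Lp), Delta / 2 <= r -> exists y : 'I_n.+1 -> Lp,
     forall a, A a -> mdist a z <= 2 * r ->
       exists i, mdist a (y i) <= r / (200 * p)) ->
  locally_covered (nbhd A ((1 / 400) / p * Delta)) (Delta / 2) n.
Proof.
move=> D0 Acov r z Dr; have [y yP] := Acov r z Dr; exists y => x [a Aa ax] xz.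
have h := near_le_double Dr.
have r0 : 0 < r by apply: lt_le_trans Dr; rewrite divr_gt0.
have rr : r / (200 * p) <= r.
  have c0 : 0 < 200 * p by apply: mulr_gt0 p0; rewrite ltr0n.
  rewrite ler_pdivrMr; last exact: c0.
  by apply: ler_peMr; [exact: ltW|have := p2; lra].
move: ax; rewrite /cball /= => ax.
have [i yi] : exists i, mdist a (y i) <= r / (200 * p).
  by apply: yP => //; have := metric_triangle a x z; lra.
exists i; have := metric_triangle x a (y i); rewrite (metric_sym x a).
have -> : r / (100 * p) = r / (200 * p) + r / (200 * p) by field; rewrite gt_eqF.
by lra.
Qed.

Lemma SEP_finite n (A : set Lp) (Delta : R) : (2 <= n)%N -> (A #= `I_n)%card -> 0 < Delta ->
  (SEP (set_type (nbhd A ((1 / 400) / p * Delta))) Delta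
    <= (128 * (40 * 960) * p ^+ 2 * Num.sqrt (ln n%:R))%:E)%E.
Proof.
case: n => // n n2 An D0.
have /card_set_bijP[f [ffun finj fsurj]] := An.
have /choice[y yP] : forall i : 'I_n.+1, exists a, A a /\ f a = i.
  by move=> i; have [a Aa fa] := fsurj _ (ltn_ord i); exists a.
have yA a : A a -> exists i, y i = a.
  move=> Aa; exists (Ordinal (ffun a Aa)); have [Ay fy] := yP (Ordinal (ffun a Aa)).
  by apply: finj; rewrite ?inE//; apply/mem_set.
have cov : locally_covered (nbhd A ((1 / 400) / p * Delta)) (Delta / 2) n.
  apply: nbhd_covered => // r z Dr; exists y => a /yA[i <-] _; exists i.
  by rewrite mdistxx divr_ge0 ?mulr_ge0 ?(ltW p0)// (le_trans _ Dr)// divr_ge0// ltW.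
(* From this radius on, the whole neighbourhood is one cluster around [y ord0], at no cost. *)
pose R1 := (1 / 400) / p * Delta + \sum_i mdist (y i) (y ord0).
apply: (le_trans (@SEP_multiscale R p p2 _ Delta n 0 R1 D0 cov (lexx 0) _)).
  move=> r rR; rewrite mul0r.
  exists unit, (fun _ _ => 1), (fun _ _ => 0%N), (fun _ _ => y ord0); split=> //.
  - by move=> x _; rewrite big_const card_unit /= addr0.
  - move=> _ x [a /yA[i <-] ax] _; apply: le_trans rR.
    rewrite (le_trans (metric_triangle _ (y i) _))// /R1 lerD//.
      by rewrite metric_sym.
    by rewrite (bigD1 i)//= lerDl sumr_ge0// => j _; exact: mdist_ge0.
  - move=> x w _ _; rewrite big1 ?mul0r// => u _.
    by rewrite /ldist eqxx subrr normr0.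
rewrite lee_fin.
have N2 : 2 <= n.+1%:R :> R by rewrite ler_nat.
have lnN : Num.sqrt (ln (2 * n.+1%:R)) <= 2 * Num.sqrt (ln n.+1%:R) :> R.
  move: (n.+1%:R : R) N2 => N N2.
  have l0 : 0 <= ln N by rewrite ln_ge0//; lra.
  apply: (@le_trans _ _ (Num.sqrt (2 * ln N))).
    rewrite ler_wsqrtr// lnM ?posrE//; last lra.
    have : ln 2 <= ln N by rewrite ler_ln ?posrE//; lra.
    by lra.
  by apply: sqrtrM_le => //; lra.
rewrite /step_cost.
move: (Num.sqrt (ln (2 * n.+1%:R))) (Num.sqrt (ln n.+1%:R)) lnN => a b ab.
rewrite [leRHS](_ : _ = 64 * p * (40 * 960 * p * (2 * b))); last by ring.
apply: ler_wpM2l; first by rewrite mulr_ge0 ?ler0n ?(ltW p0).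
by apply: ler_wpM2l ab; rewrite !mulr_ge0 ?ler0n ?(ltW p0).
Qed.

Lemma ln2_ge_half : 1 / 2 <= ln 2 :> R.
Proof.
by rewrite -[leLHS]expRK ler_ln ?posrE ?expR_gt0 ?ltr0n//; exact: expR_half_le.
Qed.

(** 800p is the ratio of 4r to r/(200p). As 800p <= p^11 and ln 2 >= 1/2, the integral part of its
    binary logarithm is at most 22 ln p, and the extra 1 is at most 2 ln p. *)
Lemma halving_count : exists m : nat,
  [/\ (0 < m)%N, 800 * p <= 2 ^+ m & m%:R <= 24 * ln p].
Proof.
have p8 : 0 <= 800 * p by apply: mulr_ge0; rewrite ?ler0n// ltW.
have N0 : (0 < Num.truncn (800 * p))%N by rewrite truncn_gt0; have := p2; lra.
have := @trunc_log_bounds 2 _ isT N0; set t := trunc_log 2 _ => /= /andP[t1 t2].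
exists t.+1; split=> //.
  have := truncnS_gt (800 * p) => /ltW /le_trans; apply.
  by rewrite -natrX ler_nat.
have tp : 2 ^+ t <= 800 * p.
  apply: (@le_trans _ _ (Num.truncn (800 * p))%:R); last by rewrite truncn_le.
  by rewrite -natrX ler_nat.
have p11 : 800 * p <= p ^+ 11.
  rewrite exprSr; apply: ler_wpM2r; first exact: ltW.
  apply: (@le_trans _ _ (2 ^+ 10)); first by rewrite -natrX ler_nat.
  by rewrite lerXn2r ?nnegrE ?ler0n ?(ltW p0).
have : ln (2 ^+ t) <= ln (p ^+ 11).
  by rewrite ler_ln ?posrE ?exprn_gt0 ?ltr0n// (le_trans tp).
rewrite !lnXn ?ltr0n// -[ln 2 *+ t]mulr_natl -[ln p *+ 11]mulr_natl => tl.
have h2 := ln2_ge_half.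
have lp : ln 2 <= ln p by rewrite ler_ln ?posrE ?ltr0n.
have t0 : 0 <= t%:R :> R by [].
by rewrite -natr1; nra.
Qed.

(** The points of D within 2r of z lie within 4r of any one of them, so m halvings approximate them
    by N = l^m points up to r/(200p). *)
Lemma SEP_doubling (lambda : R) (D : set Lp) (Delta : R) : 2 <= lambda ->
    doubling (set_type D) lambda -> 0 < Delta ->
  (SEP (set_type (nbhd D ((1 / 400) / p * Delta))) Delta
    <= (448 * (40 * 960) * (p ^+ 2 * Num.sqrt (ln p)) * Num.sqrt (ln lambda))%:E)%E.
Proof.
move=> la2 dD D0; have [m [m0 mp ml]] := halving_count.
set l := Num.truncn lambda.
have l2 : (2 <= l)%N by rewrite truncn_ge_nat// (le_trans _ la2).
pose n := (l ^ m).-1.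
have nE : n.+1 = (l ^ m)%N by rewrite /n prednK// expn_gt0 (leq_trans _ l2).
have D20 : 0 < Delta / 2 by rewrite divr_gt0.
have cov : locally_covered (nbhd D ((1 / 400) / p * Delta)) (Delta / 2) n.
  apply: nbhd_covered => // r z Dr; have r0 : 0 < r := lt_le_trans D20 Dr.
  have [[a0 [Da0 a0z]]|none] := pselect (exists a, D a /\ mdist a z <= 2 * r); last first.
    by exists (fun=> z) => a Da az; case: none; exists a.
  have c0 : 0 < 200 * p by apply: mulr_gt0 p0; rewrite ltr0n.
  have rc : 0 <= r / (200 * p) by apply: divr_ge0; apply: ltW.
  have [s [ss _ sP]] := doubling_iter dD m rc Da0.
  exists (fun i => nth a0 s i) => a Da az.
  have [|b bs ba] := sP a Da.
    apply: (@le_trans _ _ (800 * p * (r / (200 * p)))); last exact: ler_wpM2r.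
    have -> : 800 * p * (r / (200 * p)) = 4 * r by field; rewrite gt_eqF.
    have := metric_triangle a0 z a; rewrite (metric_sym z a).
    by lra.
  have bi : (index b s < n.+1)%N by rewrite nE (leq_trans _ ss)// index_mem.
  by exists (Ordinal bi); rewrite /= nth_index// metric_sym.
have [x0 _] : exists c : Lp, (c : R -> R) = (0 : R -> R) %[ae lebesgue01 R].
  by apply: exists_Lp; exact: (Lfun_submod_closed _ (lee1_ge2 p2)).1.
pose Q : R := ((l ^ 5).+1)%:R.
apply: (le_trans (@SEP_multiscale R p p2 _ Delta n (16 * Q) Delta D0 cov _ _)).
- by rewrite mulr_ge0.
- move=> r rD; have r0 : 0 < r := lt_le_trans D0 rD.
  have r4 : 0 < r / 4 by rewrite divr_gt0.
  have := @gentle_doubling _ _ D lambda dD (nbhd D ((1 / 400) / p * Delta)) x0 (r / 4) r4.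
  rewrite (_ : 4 * (r / 4) = r); last by field.
  rewrite (_ : 4 * _ / (r / 4) = 16 * Q / r); last by rewrite /Q; field; rewrite gt_eqF.
  apply=> x [d Dd dx]; exists d => //; apply: (le_trans dx).
  have h : Delta / 2 <= r by lra.
  apply: (le_trans (near_le_double h)).
  have -> : r / (200 * p) = r / 4 * (50 * p)^-1 by field; rewrite gt_eqF.
  apply: ler_piMr; first exact: ltW.
  by rewrite invf_le1; [have := p2; lra|apply: mulr_gt0 p0; rewrite ltr0n].
rewrite lee_fin /step_cost nE natrX.
have l2' : 2 <= l%:R :> R by rewrite ler_nat.
have lla : l%:R <= lambda by rewrite truncn_le; lra.
move: (l%:R : R) l2' lla => L L2 Lla.
have lnp : 0 < ln p by rewrite ln_gt0//; have := p2; lra.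
have lnla : 0 < ln lambda by rewrite ln_gt0//; lra.
have m1 : 1 <= m%:R :> R by rewrite ler1n.
(* ln 2 <= m ln lambda, so the left side is at most 2 m ln lambda <= 48 ln p ln lambda; 49 is
   rounded up to a square, and 448 = 64 times 7. *)
have key : ln (2 * L ^+ m) <= 49 * (ln p * ln lambda).
  rewrite lnM ?posrE ?exprn_gt0 ?ltr0n//; [|lra].
  rewrite lnXn; last lra.
  have h1 : ln 2 <= ln lambda by rewrite ler_ln ?posrE ?ltr0n//; lra.
  have h2 : ln L <= ln lambda by rewrite ler_ln ?posrE//; lra.
  rewrite -[ln L *+ m]mulr_natl.
  have h3 : m%:R * ln L <= m%:R * ln lambda by rewrite ler_wpM2l.
  have h4 : m%:R * ln lambda <= 24 * ln p * ln lambda by rewrite ler_wpM2r// ltW.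
  have h5 : ln lambda <= m%:R * ln lambda by rewrite ler_peMl// ltW.
  by nra.
have sq : Num.sqrt (ln (2 * L ^+ m)) <= 7 * (Num.sqrt (ln p) * Num.sqrt (ln lambda)).
  rewrite -sqrtrM ?(ltW lnp)//; apply: (le_trans (ler_wsqrtr key)).
  by apply: sqrtrM_le => //; [rewrite mulr_ge0 ?ltW|lra].
move: (Num.sqrt (ln (2 * _))) (Num.sqrt (ln p)) (Num.sqrt (ln lambda)) sq => a b c abc.
rewrite [leRHS](_ : _ = 64 * p * (40 * 960 * p * (7 * (b * c)))); last by ring.
apply: ler_wpM2l; first by rewrite mulr_ge0 ?ler0n ?(ltW p0).
by apply: ler_wpM2l abc; rewrite !mulr_ge0 ?ler0n ?(ltW p0).
Qed.

End theorem_bounds.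

Theorem theorem1p14 (R : realType) :
  exists gamma C : R, [/\ 0 < gamma, 0 < C &
    forall (p : R) (p2 : 2 <= p),
      (forall n : nat, (2 <= n)%N ->
        forall A : set (Lp (lee1_ge2 p2)), (A #= `I_n)%card ->
        forall Delta : R, 0 < Delta ->
          (SEP (set_type (nbhd A (gamma / p * Delta))) Delta
             <= (C * p ^+ 2 * Num.sqrt (ln n%:R))%:E)%E) /\
      (forall lambda : R, 2 <= lambda ->
        forall D : set (Lp (lee1_ge2 p2)), doubling (set_type D) lambda ->
        forall Delta : R, 0 < Delta ->
          (SEP (set_type (nbhd D (gamma / p * Delta))) Delta
             <= (C * (p ^+ 2 * Num.sqrt (ln p)) * Num.sqrt (ln lambda))%:E)%E)].
Proof.
(* The larger of the two constants; the finite case has 128 in place of 448. *)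
exists (1 / 400), (448 * (40 * 960)); split.
- by apply: divr_gt0; [exact: ltr01|rewrite ltr0n].
- by apply: mulr_gt0; [|apply: mulr_gt0]; rewrite ltr0n.
move=> p p2; split=> [n n2 A An Delta D0|lambda la2 D dD Delta D0]; last first.
  exact: SEP_doubling.
apply: (le_trans (SEP_finite n2 An D0)); rewrite lee_fin.
apply: ler_wpM2r; first exact: sqrtr_ge0.
apply: ler_wpM2r; first exact: sqr_ge0.
by apply: ler_wpM2r; [apply: mulr_ge0; rewrite ler0n|rewrite ler_nat].
Qed.
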